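(* Let $\mathcal A$ be an approximately unital operator algebra, let $a:\mathcal A\to\mathbb B(H)$ be a completely isometric homomorphism and let $M\subseteq\mathbb B(H,K)$ be a $\sigma$-TRO such that $M^\star M\,a(\mathcal A)\subseteq a(\mathcal A)$. Consider the $\sigma\Delta$-$\mathcal A$-rigged module $Y=\overline{[M\,a(\mathcal A)]}$. Then there exist operator algebras $\mathcal A_0,\mathcal B$ with contractive approximate identities and a restriction $Z$ of $Y$ such that $Z$ is a doubly $\sigma\Delta$-$\mathcal A_0$-rigged module and $\mathcal A_0\sim_{\sigma TRO}\mathcal B\sim_{\sigma TRO}Z$.
   Context: Approximately unital means having a contractive approximate identity. $\mathbb B(H,K)$ is the space of bounded operators $H\to K$; $\overline{[Z\,X]}$, $\overline{[Z\,W\,X]}$ denote norm closures of linear spans of products. A linear subspace $M\subseteq\mathbb B(H,K)$ is a TRO if $MM^\star M\subseteq M$. A norm closed TRO $M$ is a $\sigma$-TRO if there are sequences $(m_i),(n_j)$ in $M$ with $\lim_n\sum_{i=1}^n m_im_i^\star m=m$ and $\lim_t\sum_{j=1}^t m\,n_j^\star n_j=m$ for all $m\in M$, and $\|\sum_{i=1}^n m_im_i^\star\|\le1$, $\|\sum_{j=1}^t n_j^\star n_j\|\le1$ for all $n,t$. Operator spaces $X\subseteq\mathbb B(H,K)$, $W\subseteq\mathbb B(L,R)$ satisfy $X\sim_{\sigma TRO}W$ if there are $\sigma$-TROs $M_1\subseteq\mathbb B(H,L)$, $M_2\subseteq\mathbb B(K,R)$ with $X=\overline{[M_2^\star WM_1]}$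 and $W=\overline{[M_2XM_1^\star]}$. A right $\mathcal A$-module $Y$ (an operator space) is a $\sigma\Delta$-$\mathcal A$-rigged module if there are a completely isometric homomorphism $a:\mathcal A\to a(\mathcal A)\subseteq\mathbb B(H)$, a $\sigma$-TRO $M\subseteq\mathbb B(H,K)$ with $M^\star M\,a(\mathcal A)\subseteq a(\mathcal A)$, and a surjective complete isometry $\rho:Y\to Y_0=\overline{[M\,a(\mathcal A)]}$ that is a right $\mathcal A$-module map. It is a doubly $\sigma\Delta$-$\mathcal A$-rigged module if these can be chosen with also $\overline{[M^\star M\,a(\mathcal A)]}=\overline{[a(\mathcal A)\,M^\star M]}$. For a $\sigma\Delta$-$\mathcal A$-rigged module $Y$ presented by such $a$, $M$, the operator space $Z=\overline{[Y_0\,M^\star M]}=\overline{[M\,a(\mathcal A)\,M^\star M]}\subseteq\mathbb B(H,K)$ is called a restriction of $Y$. *)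

(* Defs.v *)
From HB Require Import structures.
From mathcomp Require Import all_boot all_order all_algebra.
From mathcomp Require Import sesquilinear complex.
From mathcomp Require Import all_classical all_reals all_analysis.

Set Implicit Arguments.
Unset Strict Implicit.
Unset Printing Implicit Defensive.

Import Order.TTheory GRing.Theory Num.Theory.
Import numFieldNormedType.Exports.

Local Open Scope complex_scope.
Local Open Scope classical_set_scope.
Local Open Scope ring_scope.

(* The inner product is linear in its first argument. *)
HB.mixin Record CompleteNormedModule_isHilbert (R : realType) (H : Type)
    & CompleteNormedModule R[i] H := {
  inner : {dot H for (@Num.conj R[i])} ;
  inner_norm : forall x : H, inner x x = `|x| ^+ 2
}.

#[short(type="hilbertType")]
HB.structure Definition Hilbert (R : realType) :=
  {H of CompleteNormedModule_isHilbert R H & CompleteNormedModule R[i] H}.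

Section BoundedOperators.
Variables (R : realType) (H K : hilbertType R).

Definition bounded_linear : {pred H -> K} :=
  fun f => `[< linear f /\ continuous f >].

Lemma bounded_linear_submod_closed : submod_closed bounded_linear.
Proof.
split=> [|c f g /asboolP[fl fc] /asboolP[gl gc]]; apply/asboolP; split.
- by move=> c x y /=; rewrite scaler0 addr0.
- by move=> x; exact: cvg_cst.
- move=> d x y; have -> : forall z, (c *: f + g) z = c *: f z + g z by [].
  rewrite fl gl !scalerDr !scalerA (mulrC c) -!addrA; congr (_ + _).
  by rewrite addrCA.
- by move=> x; apply: cvgD; [apply: cvgZr; exact: fc|exact: gc].
Qed.

HB.instance Definition _ :=
  GRing.isSubmodClosed.Build R[i] (H -> K) bounded_linear
    bounded_linear_submod_closed.

Record bop := Bop { bop_fun :> H -> K ; bopP : bop_fun \in bounded_linear }.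

HB.instance Definition _ := [isSub for bop_fun].
HB.instance Definition _ := [Choice of bop by <:].
HB.instance Definition _ := [SubChoice_isSubLmodule of bop by <:].

End BoundedOperators.

Section RealNorm.
Variables (R : realType) (V : normedModType R[i]).

(* The norm of a normedModType R[i] takes values in R[i]; this is its real part. *)
Definition rnorm (x : V) : R := complex.Re `|x|.

Lemma rnormE x : (rnorm x)%:C = `|x|.
Proof. by apply: RRe_real; exact: normr_real. Qed.

Lemma rnorm_ge0 x : 0 <= rnorm x.
Proof. by rewrite -lecR rnormE; exact: normr_ge0. Qed.

Lemma rnormD x y : rnorm (x + y) <= rnorm x + rnorm y.
Proof. by rewrite -lecR rmorphD/= !rnormE ler_normD. Qed.

Lemma rnormZ c x : rnorm (c *: x) = complex.Re `|c| * rnorm x.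
Proof.
apply: (@complexI R); rewrite rmorphM/= !rnormE normrZ.
by congr (_ * _); apply: RRe_real; exact: normr_real.
Qed.

Lemma rnorm0 : rnorm 0 = 0.
Proof. by rewrite /rnorm normr0. Qed.

Lemma rnorm_eq0 x : rnorm x = 0 -> x = 0.
Proof. by move=> x0; apply/normr0_eq0; rewrite -rnormE x0. Qed.

End RealNorm.

Section OperatorNorm.
Variables (R : realType) (H K : hilbertType R).
Implicit Types S T : bop H K.

Lemma bop_linear T : linear T.
Proof. by have /asboolP[] := bopP T. Qed.

HB.instance Definition _ T :=
  GRing.isLinear.Build R[i] H K _ (bop_fun T) (bop_linear T).

Lemma bop_continuous T : continuous T.
Proof. by have /asboolP[] := bopP T. Qed.

Lemma bopDE S T x : (S + T) x = S x + T x. Proof. by []. Qed.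
Lemma bopZE c T x : (c *: T) x = c *: T x. Proof. by []. Qed.
Lemma bop0E x : (0 : bop H K) x = 0. Proof. by []. Qed.

Lemma bop_ext S T : S =1 T -> S = T.
Proof. by move=> ST; apply: val_inj; exact/funext. Qed.

Definition opnormR T : R :=
  sup [set rnorm (T x) | x in [set x : H | rnorm x <= 1]].

Lemma bop_bounded T : exists2 M : R, 0 <= M & forall x, rnorm (T x) <= M * rnorm x.
Proof.
have /(linear_bounded_continuous T).2/linear_boundedP : continuous T.
  exact: bop_continuous.
move=> /pinfty_ex_gt0[M M0 TM].
have ReM : (complex.Re M)%:C = M by apply: RRe_real; exact: gtr0_real.
exists (complex.Re M); first by rewrite -lecR ReM; exact: ltW.
by move=> x; rewrite -lecR rmorphM/= !rnormE ReM; exact: TM.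
Qed.

Lemma opnormR_has_sup T :
  has_sup [set rnorm (T x) | x in [set x : H | rnorm x <= 1]].
Proof.
have [M M0 TM] := bop_bounded T; split.
  by exists (rnorm (T 0)), 0 => //=; rewrite rnorm0.
exists M => _ [x /= x1 <-]; apply: (le_trans (TM x)).
by rewrite -[leRHS]mulr1 ler_wpM2l.
Qed.

Lemma rnorm_bop T x : rnorm (T x) <= opnormR T * rnorm x.
Proof.
have [->|x0] := eqVneq x 0; first by rewrite linear0 !rnorm0 mulr0.
have nx0 : 0 < rnorm x.
  by rewrite lt_neqAle rnorm_ge0 andbT eq_sym; apply: contra_neq x0 => /rnorm_eq0.
rewrite -ler_pdivrMr// mulrC.
have rc (r : R) : 0 <= r -> complex.Re `|r%:C| = r.
  by move=> r0; rewrite normc_def/= expr0n addr0 sqrtr_sqr ger0_norm.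
apply: sup_upper_bound; first exact: opnormR_has_sup.
exists ((rnorm x)^-1%:C *: x).
  by rewrite /= rnormZ rc ?invr_ge0 ?rnorm_ge0// mulVf// gt_eqF.
by rewrite linearZ rnormZ rc// invr_ge0 rnorm_ge0.
Qed.

Lemma opnormR_le T M : 0 <= M -> (forall x, rnorm (T x) <= M * rnorm x) ->
  opnormR T <= M.
Proof.
move=> M0 TM; apply: ge_sup; first by have [] := opnormR_has_sup T.
move=> _ [x /= x1 <-]; apply: (le_trans (TM x)).
by rewrite -[leRHS]mulr1 ler_wpM2l.
Qed.

Lemma opnormR_ge0 T : 0 <= opnormR T.
Proof.
apply: sup_upper_bound; first exact: opnormR_has_sup.
by exists 0; rewrite /= ?rnorm0 ?ler01// linear0 rnorm0.
Qed.

Definition opnorm T : R[i] := (opnormR T)%:C.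

Lemma opnormD S T : opnorm (S + T) <= opnorm S + opnorm T.
Proof.
rewrite /opnorm -rmorphD lecR opnormR_le ?addr_ge0 ?opnormR_ge0// => x.
by rewrite bopDE (le_trans (rnormD _ _))// mulrDl lerD// rnorm_bop.
Qed.

Lemma opnormZ c T : opnorm (c *: T) = `|c| * opnorm T.
Proof.
have [r rE] : exists r : R[i] -> R, forall d, (r d)%:C = `|d|.
  by exists (fun d => complex.Re `|d|) => d; apply: RRe_real; exact: normr_real.
have r_ge0 d : 0 <= r d by rewrite -lecR rE; exact: normr_ge0.
have rnormZr d (x : K) : rnorm (d *: x) = r d * rnorm x.
  by apply: (@complexI R); rewrite rmorphM/= !rnormE rE normrZ.
have leZ d S : opnormR (d *: S) <= r d * opnormR S.
  apply: opnormR_le => [|x]; first by rewrite mulr_ge0 ?opnormR_ge0.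
  by rewrite bopZE rnormZr -mulrA ler_wpM2l// rnorm_bop.
rewrite /opnorm -rE -rmorphM; congr (_%:C).
apply/eqP; rewrite eq_le leZ andTb.
have [->|c0] := eqVneq c 0.
  have -> : r 0 = 0 by apply: (@complexI R); rewrite rE normr0.
  by rewrite mul0r opnormR_ge0.
have rV : r c^-1 = (r c)^-1.
  by apply: (@complexI R); rewrite rE normfV -rE fmorphV.
have rc0 : 0 < r c by rewrite -ltcR rE; change (0 < `|c|); rewrite normr_gt0.
rewrite mulrC -ler_pdivlMr// mulrC -rV.
by have := leZ c^-1 (c *: T); rewrite scalerA mulVf// scale1r.
Qed.

Lemma opnorm_eq0 T : opnorm T = 0 -> T = 0.
Proof.
move=> /(@complexI R _ 0) T0; apply: bop_ext => x; apply: rnorm_eq0.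
by apply/eqP; rewrite eq_le rnorm_ge0 andbT (le_trans (rnorm_bop T x))// T0 mul0r.
Qed.

HB.instance Definition _ :=
  Lmodule_isNormed.Build R[i] (bop H K) opnormD opnormZ opnorm_eq0.

End OperatorNorm.

Notation "''B' ( H , K )" := (bop H K)
  (at level 8, format "''B' ( H ,  K )") : type_scope.

Section Composition.
Variables (R : realType) (H K L : hilbertType R).

Lemma bcomp_subproof (S : 'B(K, L)) (T : 'B(H, K)) :
  (S \o T) \in @bounded_linear R H L.
Proof.
apply/asboolP; split=> [c x y|x] /=; first by rewrite !linearP.
by apply: continuous_comp; exact: bop_continuous.
Qed.

Definition bcomp (S : 'B(K, L)) (T : 'B(H, K)) : 'B(H, L) :=
  Bop (bcomp_subproof S T).

Definition prodset (X : set 'B(K, L)) (Y : set 'B(H, K)) : set 'B(H, L) :=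
  [set bcomp S T | S in X & T in Y].

End Composition.

Infix "\ob" := bcomp (at level 40, left associativity) : ring_scope.
Infix "**" := prodset (at level 40, left associativity) : classical_set_scope.

Section Adjoint.
Variables (R : realType) (H K : hilbertType R).

(* By the Riesz representation theorem the set below is a singleton, so the
   default value of [get] is never used. *)
Definition adj (T : 'B(H, K)) : 'B(K, H) :=
  get [set S : 'B(K, H) | forall x y, inner (T x) y = inner x (S y)].

Definition adjset (M : set 'B(H, K)) : set 'B(K, H) := adj @` M.

End Adjoint.

Notation "M ^⋆" := (adjset M) (at level 2, format "M ^⋆") : classical_set_scope.

Section Subspaces.
Variables (R : realType) (H K : hilbertType R).
Implicit Types X M : set 'B(H, K).

Definition subspace X :=
  X 0 /\ forall (c : R[i]) S T, X S -> X T -> X (c *: S + T).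

Definition span X : set 'B(H, K) :=
  [set T | exists (n : nat) (c : 'I_n -> R[i]) (s : 'I_n -> 'B(H, K)),
    (forall i, X (s i)) /\ T = \sum_(i < n) c i *: s i].

Definition clspan X : set 'B(H, K) := closure (span X).

Definition operator_space X := subspace X /\ closed X.

Definition TRO M := subspace M /\ M ** M^⋆ ** M `<=` M.

Definition sigma_TRO M :=
  [/\ TRO M, closed M &
    exists m n : nat -> 'B(H, K),
    [/\ forall i, M (m i) /\ M (n i),
        forall x, M x ->
          \sum_(0 <= i < k) (m i \ob adj (m i) \ob x) @[k --> \oo] --> x,
        forall x, M x ->
          \sum_(0 <= j < k) (x \ob adj (n j) \ob n j) @[k --> \oo] --> x,
        forall k, `|\sum_(0 <= i < k) (m i \ob adj (m i))| <= 1 &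
        forall k, `|\sum_(0 <= j < k) (adj (n j) \ob n j)| <= 1]].

(* The norm of a matrix of operators, seen as an operator H^n -> K^n between
   Hilbert space direct sums. *)
Definition matrix_opnorm (n : nat) (T : 'M['B(H, K)]_n) : R :=
  sup [set Num.sqrt (\sum_(i < n) rnorm (\sum_(j < n) T i j (x j)) ^+ 2)
      | x in [set x : 'I_n -> H | \sum_(j < n) rnorm (x j) ^+ 2 <= 1]].

End Subspaces.

(* Maps on a set X of operators are total functions on the ambient space, of
   which only the values on X matter. *)
Section Maps.
Variables (R : realType) (E F H K : hilbertType R).

Definition linear_on (X : set 'B(E, F)) (f : 'B(E, F) -> 'B(H, K)) :=
  forall (c : R[i]) S T, X S -> X T -> f (c *: S + T) = c *: f S + f T.

Definition complete_isometry_on (X : set 'B(E, F)) (f : 'B(E, F) -> 'B(H, K)) :=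
  linear_on X f /\
  forall (n : nat) (T : 'M['B(E, F)]_n), (forall i j, X (T i j)) ->
    matrix_opnorm (map_mx f T) = matrix_opnorm T.

End Maps.

Section OperatorAlgebras.
Variables (R : realType) (E : hilbertType R).
Implicit Types A : set 'B(E, E).

Definition operator_algebra A := operator_space A /\ A ** A `<=` A.

Definition directed (I : Type) (le : I -> I -> Prop) :=
  [/\ inhabited I, forall i, le i i,
      forall i j k, le i j -> le j k -> le i k &
      forall i j, exists k, le i k /\ le j k].

Definition approximately_unital A :=
  exists (I : Type) (le : I -> I -> Prop) (e : I -> 'B(E, E)),
  [/\ directed le, forall i, A (e i) /\ `|e i| <= 1 &
      forall T, A T -> forall eps : R[i], 0 < eps ->
        exists i0, forall i, le i0 i ->
          `|e i \ob T - T| < eps /\ `|T \ob e i - T| < eps].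

Definition ci_homomorphism (H : hilbertType R) A (a : 'B(E, E) -> 'B(H, H)) :=
  complete_isometry_on A a /\
  forall S T, A S -> A T -> a (S \ob T) = a S \ob a T.

End OperatorAlgebras.

Definition sigma_TRO_equiv (R : realType) (H K L P : hilbertType R)
    (X : set 'B(H, K)) (W : set 'B(L, P)) :=
  exists (M1 : set 'B(H, L)) (M2 : set 'B(K, P)),
  [/\ sigma_TRO M1, sigma_TRO M2,
      X = clspan (M2^⋆ ** W ** M1) & W = clspan (M2 ** X ** M1^⋆)].

Section RiggedModules.
Variables (R : realType) (E F G : hilbertType R).
Variables (A : set 'B(E, E)) (Y : set 'B(F, G)).
Variable act : 'B(F, G) -> 'B(E, E) -> 'B(F, G).

Definition right_module :=
  [/\ forall y x, Y y -> A x -> Y (act y x),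
      forall (c : R[i]) y z x, Y y -> Y z -> A x ->
        act (c *: y + z) x = c *: act y x + act z x,
      forall (c : R[i]) y x w, Y y -> A x -> A w ->
        act y (c *: x + w) = c *: act y x + act y w &
      forall y x w, Y y -> A x -> A w -> act y (x \ob w) = act (act y x) w].

Definition rigged_by (H K : hilbertType R) (a : 'B(E, E) -> 'B(H, H))
    (M : set 'B(H, K)) (rho : 'B(F, G) -> 'B(H, K)) :=
  [/\ ci_homomorphism A a,
      sigma_TRO M,
      M^⋆ ** M ** (a @` A) `<=` a @` A,
      complete_isometry_on Y rho /\ rho @` Y = clspan (M ** (a @` A)) &
      forall y x, Y y -> A x -> rho (act y x) = rho y \ob a x].

Definition doubly_sigma_rigged_module :=
  [/\ operator_space Y, right_module &
      exists (H K : hilbertType R) (a : 'B(E, E) -> 'B(H, H))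
        (M : set 'B(H, K)) (rho : 'B(F, G) -> 'B(H, K)),
      rigged_by a M rho /\
      clspan (M^⋆ ** M ** (a @` A)) = clspan (a @` A ** (M^⋆ ** M))].

End RiggedModules.

(* Y is the rigged module presented by [a] and [M], in its concrete form
   [clspan (M ** (a @` A))]; the restriction depends on the presentation only
   through Y and M. *)
Definition restriction (R : realType) (H K : hilbertType R)
    (M Y : set 'B(H, K)) : set 'B(H, K) :=
  clspan (Y ** (M^⋆ ** M)).

(* Main.v *)
(* Write [al] for [a @` A], [Q] for [M^⋆ ** M] and [D] for the C*-algebra
   [clspan Q]. We take [A0 = B = clspan (Q ** al ** Q)] and let it act on
   [Z = clspan (M ** al ** Q)] by composition. Since [clspan (M ** Q) = M], the
   algebra [A0] absorbs [D] on both sides, [Z = clspan (M ** A0)] and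
   [A0 = clspan (M^⋆ ** Z)], so [D] and [M] implement both equivalences.

   Two points need analysis. (1) If [e_i] is the approximate identity of [al]
   and [d_k = sum_(j < k) n_j^* n_j], then [d_k e_i d_k] is one for [A0]: the
   issue is that [x e_i] tends to [x] for [x] in [A0] although [al ** Q] is not
   assumed to lie in [al]. It rests on the fact that a contraction [e] nearly
   fixing [x] on the left has an adjoint nearly fixing [x]. (2) [D] is a
   sigma-TRO, by the elements [m_i^* n_j] and their adjoints.

   The operator [adj] is controlled through the Riesz representation theorem,
   proved for the real inner product [rin], the real part of [inner]. *)

Require Import Defs.
From HB Require Import structures.
From mathcomp Require Import all_boot all_order all_algebra.
From mathcomp Require Import sesquilinear complex ring lra.
From mathcomp Require Import all_classical all_reals all_analysis.

Set Implicit Arguments.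
Unset Strict Implicit.
Unset Printing Implicit Defensive.

Import Order.TTheory GRing.Theory Num.Theory.
Import numFieldNormedType.Exports.

Local Open Scope complex_scope.
Local Open Scope classical_set_scope.
Local Open Scope ring_scope.

(** * Norms, limits and closures with real epsilons *)

Section MetricForm.
Variables (R : realType) (V : normedModType R[i]).
Implicit Types (x y : V) (X : set V).

Lemma rnormN x : rnorm (- x) = rnorm x.
Proof. by rewrite /rnorm normrN. Qed.

Lemma rdistC x y : rnorm (x - y) = rnorm (y - x).
Proof. by rewrite /rnorm distrC. Qed.

Lemma Re_norm_real (r : R) : complex.Re `|r%:C| = `|r|.
Proof. by rewrite normc_def/= expr0n addr0 sqrtr_sqr. Qed.

Lemma rnormZR (r : R) x : rnorm (r%:C *: x) = `|r| * rnorm x.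
Proof. by rewrite rnormZ Re_norm_real. Qed.

Lemma rnorm_triangle z x y : rnorm (x - y) <= rnorm (x - z) + rnorm (z - y).
Proof. by rewrite (le_trans _ (rnormD _ _))// addrA subrK. Qed.

(** The order of [R[i]] only compares numbers with equal imaginary parts, so a positive number is
    real. Every epsilon in [R[i]] can thus be traded for one in [R]. *)
Lemma gt0_RR (e : R[i]) : 0 < e -> e = (complex.Re e)%:C.
Proof. by move=> e0; rewrite RRe_real//; exact: gtr0_real. Qed.

Lemma gt0_Re (e : R[i]) : 0 < e -> 0 < complex.Re e.
Proof. by move=> e0; rewrite -ltcR -(gt0_RR e0). Qed.

Lemma norm_ltE x (e : R[i]) : 0 < e -> (`|x| < e) = (rnorm x < complex.Re e).
Proof. by move=> e0; rewrite -ltcR rnormE -(gt0_RR e0). Qed.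

Lemma norm_leE x (r : R) : (`|x| <= r%:C) = (rnorm x <= r).
Proof. by rewrite -lecR rnormE. Qed.

Lemma cvg_rnormP (u : nat -> V) x : u @ \oo --> x <->
  forall e : R, 0 < e -> exists N, forall n, (N <= n)%N -> rnorm (u n - x) < e.
Proof.
split=> [/cvgrPdist_lt ux e e0|ux].
  have e0' : 0 < e%:C by rewrite ltcR.
  have [N _ uN] := ux _ e0'; exists N => n Nn.
  by have := uN n Nn; rewrite /= norm_ltE// rdistC.
apply/cvgrPdist_lt => e e0; have [N uN] := ux _ (gt0_Re e0).
by exists N => // n /= /uN; rewrite norm_ltE// rdistC.
Qed.

Lemma closure_rnormP X x : closure X x <->
  forall e : R, 0 < e -> exists2 y, X y & rnorm (x - y) < e.
Proof.
split=> [cXx e e0|cXx B].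
  have e0' : 0 < e%:C by rewrite ltcR.
  have [y [Xy]] := cXx _ (nbhsx_ballx x _ e0').
  by rewrite -ball_normE/= norm_ltE//; exists y.
move=> /nbhs_ballP[e /= e0 eB]; have [y Xy xy] := cXx _ (gt0_Re e0).
by exists y; split=> //; apply: eB; rewrite -ball_normE/= norm_ltE.
Qed.

End MetricForm.

Lemma complete_rnorm (R : realType) (V : completeNormedModType R[i]) (u : nat -> V) :
  (forall e : R, 0 < e -> exists N, forall n, (N <= n)%N -> rnorm (u N - u n) < e) ->
  exists x : V, u @ \oo --> x.
Proof.
move=> cu; suff : cvg (u @ \oo) by exists (lim (u @ \oo)).
apply: cauchy_cvg; apply: cauchy_exP => e e0.
have [N uN] := cu _ (gt0_Re e0); exists (u N); exists N => // n /= /uN.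
by rewrite -ball_normE/= norm_ltE.
Qed.

(** * The real inner product and Riesz representation *)

Lemma Re_conj (R : realType) (z : R[i]) : complex.Re (Num.conj z) = complex.Re z.
Proof. by case: z. Qed.

Lemma Re_mulR (R : realType) (c : R) (z : R[i]) :
  complex.Re (c%:C * z) = c * complex.Re z.
Proof. by case: z => p q /=; rewrite mul0r subr0. Qed.

Section RealInner.
Variables (R : realType) (H : hilbertType R).
Implicit Types x y z : H.

Definition rin x y : R := complex.Re (inner x y).

Lemma rinC x y : rin x y = rin y x.
Proof.
by rewrite /rin hermC expr0 mul1r; exact: Re_conj.
Qed.

Lemma rinDl x y z : rin (x + y) z = rin x z + rin y z.
Proof. by rewrite /rin linearDl raddfD. Qed.

Lemma rinZl c x z : rin (c *: x) z = complex.Re (c * inner x z).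
Proof. by rewrite /rin linearZl_LR. Qed.

Lemma rinZRl (c : R) x z : rin (c%:C *: x) z = c * rin x z.
Proof. by rewrite rinZl Re_mulR. Qed.

Lemma rin0l x : rin 0 x = 0.
Proof. by rewrite /rin linear0l. Qed.

Lemma rinNl x y : rin (- x) y = - rin x y.
Proof. by rewrite /rin linearNl raddfN. Qed.

Lemma rinBl x y z : rin (x - y) z = rin x z - rin y z.
Proof. by rewrite rinDl rinNl. Qed.

Lemma rinDr x y z : rin x (y + z) = rin x y + rin x z.
Proof. by rewrite !(rinC x) rinDl. Qed.

Lemma rinBr x y z : rin x (y - z) = rin x y - rin x z.
Proof. by rewrite !(rinC x) rinBl. Qed.

Lemma rinZRr (c : R) x z : rin x (c%:C *: z) = c * rin x z.
Proof. by rewrite !(rinC x) rinZRl. Qed.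

Lemma rinZr c x z : rin x (c *: z) = rin (Num.conj c *: x) z.
Proof. by rewrite /rin linearZl_LR linearZr_LR. Qed.

Lemma rin0r x : rin x 0 = 0.
Proof. by rewrite rinC rin0l. Qed.

Lemma rin_suml I (r : seq I) (P : pred I) (F : I -> H) y :
  rin (\sum_(i <- r | P i) F i) y = \sum_(i <- r | P i) rin (F i) y.
Proof.
elim/big_rec2 : _ => [|i s t _ <-]; first exact: rin0l.
by rewrite rinDl.
Qed.

Lemma rinxx x : rin x x = rnorm x ^+ 2.
Proof.
by apply: (@complexI R); rewrite /rin inner_norm rmorphXn/= -rnormE -rmorphXn.
Qed.

Lemma rnorm_sqrD x y : rnorm (x + y) ^+ 2 = rnorm x ^+ 2 + 2 * rin x y + rnorm y ^+ 2.
Proof. by rewrite -!rinxx rinDl !rinDr (rinC y x); ring. Qed.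

Lemma rnorm_sqrB x y : rnorm (x - y) ^+ 2 = rnorm x ^+ 2 - 2 * rin x y + rnorm y ^+ 2.
Proof. by rewrite -!rinxx rinBl !rinBr (rinC y x); ring. Qed.

Lemma rin_amgm x y : 2 * rin x y <= rnorm x ^+ 2 + rnorm y ^+ 2.
Proof. by have := sqr_ge0 (rnorm (x - y)); rewrite rnorm_sqrB; lra. Qed.

(** Cauchy-Schwarz: [rin_amgm] applied to the normalized vectors, once the zero vectors are set
    aside. *)
Lemma rin_le x y : rin x y <= rnorm x * rnorm y.
Proof.
have [->|y0] := eqVneq y 0; first by rewrite rin0r rnorm0 mulr0.
have [->|x0] := eqVneq x 0; first by rewrite rin0l rnorm0 mul0r.
have p z : z != 0 :> H -> 0 < rnorm z.
  move=> z0; rewrite lt_neqAle rnorm_ge0 andbT eq_sym.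
  by apply: contra_neq z0 => /rnorm_eq0.
have := rin_amgm ((rnorm x)^-1%:C *: x) ((rnorm y)^-1%:C *: y).
rewrite rinZRl rinZRr !rnormZR !ger0_norm ?invr_ge0 ?rnorm_ge0//.
rewrite !mulVf ?gt_eqF ?p// expr1n [_ * (_ * rin _ _)]mulrA -invfM => h.
suff : (rnorm x * rnorm y)^-1 * rin x y <= 1.
  by rewrite mulrC ler_pdivrMr ?mulr_gt0 ?p// mul1r.
by lra.
Qed.

Lemma rin_abs_le x y : `|rin x y| <= rnorm x * rnorm y.
Proof. by rewrite ler_norml lerNl -rinNl -[in X in X && _](rnormN x) !rin_le. Qed.

Lemma rin_inj y z : (forall x, rin x y = rin x z) -> y = z.
Proof.
move=> yz; apply/eqP; rewrite -subr_eq0; apply/eqP; apply: rnorm_eq0; apply/eqP.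
by rewrite -sqrf_eq0 -rinxx rinBr yz subrr.
Qed.

(* Minimizes [rnorm x ^+ 2 - 2 * g x]: by the parallelogram identity a
   minimizing sequence is Cauchy, and its limit represents g. *)
Lemma riesz (g : H -> R) (C : R) :
  {morph g : x y / x + y} -> (forall c x, g (c%:C *: x) = c * g x) ->
  (forall x, g x <= C * rnorm x) ->
  exists z, forall x, g x = rin x z.
Proof.
move=> gD gZ gC; pose J x := rnorm x ^+ 2 - 2 * g x.
pose m := inf (range J).
have mJ x : m <= J x.
  apply: ge_inf; last by exists x.
  (* Completing the square: [rnorm y ^+ 2 - 2 * C * rnorm y] is at least [- C ^+ 2]. *)
  exists (- C ^+ 2) => _ [y _ <-]; rewrite /J.
  by have := gC y; have := sqr_ge0 (rnorm y - C); nra.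
have /choice[u uJ] : forall n : nat, exists x, J x < m + n.+1%:R^-1.
  move=> n; have n0 : 0 < n.+1%:R^-1 :> R by rewrite invr_gt0 ltr0n.
  have hJ : has_inf (range J).
    by split; [exists (J 0), 0|exists m => _ [x _ <-]].
  by have [_ [x _ <-] Jx] := inf_adherent n0 hJ; exists x.
(* At the midpoint of [x] and [y], four times [J] equals [2 * J x + 2 * J y - rnorm (x - y) ^+ 2],
   and it is at least [4 * m]. *)
have dist x y : rnorm (x - y) ^+ 2 <= 2 * J x + 2 * J y - 4 * m.
  have := mJ ((2^-1 : R)%:C *: (x + y)).
  rewrite rnorm_sqrB /J gZ gD rnormZR ger0_norm ?invr_ge0// exprMn rnorm_sqrD.
  lra.
have [z uz] : exists z : H, u @ \oo --> z.
  apply: complete_rnorm => e e0.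
  (* For [n >= N], [dist] bounds the squared distance by four times [N.+1%:R^-1]. *)
  have e40 : 0 < e ^+ 2 / 4 by rewrite divr_gt0 ?exprn_gt0.
  have [N NE] : exists N : nat, N.+1%:R^-1 < e ^+ 2 / 4 :> R.
    have [N _ NE] := near_infty_natSinv_lt (PosNum e40).
    by exists N; exact: NE (leqnn N).
  exists N => n Nn; rewrite -(@ltr_pXn2r _ 2)// ?nnegrE ?rnorm_ge0 ?ltW//.
  apply: (le_lt_trans (dist _ _)); have := uJ N; have := uJ n.
  have : n.+1%:R^-1 <= N.+1%:R^-1 :> R by rewrite lef_pV2 ?posrE ?ltr0n// ler_nat.
  move: NE; rewrite ltr_pdivlMr//.
  move: (N.+1%:R^-1 : R) (n.+1%:R^-1 : R) (J (u n)) (J (u N)) (e ^+ 2) => p q r s t.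
  by lra.
exists z => y; apply/eqP; rewrite eq_sym -subr_eq0 -normr_le0.
apply/ler_addgt0Pl => e e0; rewrite addr0.
pose Y := rnorm y ^+ 2 + 1.
have Y0 : 0 < Y by rewrite ltr_wpDl// sqr_ge0.
have y1 : 0 < rnorm y + 1 by rewrite ltr_wpDl// rnorm_ge0.
have e20 : 0 < e / 2 by rewrite divr_gt0.
have eY0 : 0 < (e / 2) ^+ 2 / Y by rewrite divr_gt0// exprn_gt0.
have ey0 : 0 < e / 2 / (rnorm y + 1) by rewrite divr_gt0.
have [N1 _ N1E] := near_infty_natSinv_lt (PosNum eY0).
have [N2 N2E] := (cvg_rnormP u z).1 uz _ ey0.
set n := maxn N1 N2.
have nE : n.+1%:R^-1 < (e / 2) ^+ 2 / Y :> R := N1E _ (leq_maxl N1 N2).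
have /ltW := N2E _ (leq_maxr N1 N2); rewrite -/n ler_pdivlMr// => zE.
(* The number [s] measures how far [u n] is from representing [g] at [y]. Adding [t *: y] with
   [t = - s / Y] to [u n] lowers [J] by at least [s ^+ 2 / Y], while [J (u n)] exceeds [m] by less
   than [n.+1%:R^-1]. The summand 1 in [Y] avoids a division by zero. *)
set s := rin (u n) y - g y.
have s2 : s ^+ 2 < (e / 2) ^+ 2.
  have := mJ (u n + (- s / Y)%:C *: y); have := uJ n.
  rewrite /J rnorm_sqrD rinZRr gD gZ rnormZR exprMn real_normK ?num_real//.
  set t := - s / Y => Jn Jt.
  have sE : rin (u n) y = s + g y by rewrite /s subrK.
  rewrite sE in Jt.
  have tY : t * Y = - s by rewrite /t divfK ?gt_eqF.
  have yE : rnorm y ^+ 2 = Y - 1 by rewrite /Y addrK.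
  have st : - (t * s) < (e / 2) ^+ 2 / Y.
    rewrite yE in Jt; have : t ^+ 2 * (Y - 1) = - (t * s) - t ^+ 2.
      by rewrite mulrBr mulr1 expr2 -mulrA tY mulrN.
    have := sqr_ge0 t; move: Jt Jn nE.
    by move: (n.+1%:R^-1 : R) => q; lra.
  have : - (t * s) * Y < (e / 2) ^+ 2 by rewrite -ltr_pdivlMr.
  by rewrite mulNr mulrAC tY mulNr opprK -expr2.
have sl : `|s| <= e / 2.
  rewrite -(@ler_pXn2r _ 2)// ?nnegrE ?(ltW e20)//.
  by rewrite real_normK ?num_real// ltW.
have -> : rin y z - g y = s - rin (u n - z) y by rewrite /s rinBl (rinC y); ring.
rewrite (le_trans (ler_normB _ _))// [leRHS](_ : _ = e / 2 + e / 2); last by field.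
rewrite lerD//; apply: (le_trans (rin_abs_le _ _)).
rewrite (le_trans _ zE)// ler_wpM2l ?rnorm_ge0//.
by rewrite lerDl.
Qed.

End RealInner.

(** * Operator norm and composition *)

Section BopNorm.
Variables (R : realType) (H K : hilbertType R).

Lemma bop_le (T : 'B(H, K)) x : rnorm (T x) <= rnorm T * rnorm x.
Proof. exact: rnorm_bop. Qed.

Lemma bop_norm_le (T : 'B(H, K)) C : 0 <= C ->
  (forall x, rnorm (T x) <= C * rnorm x) -> rnorm T <= C.
Proof. exact: opnormR_le. Qed.

Lemma bop_norm_sqr_le (T : 'B(H, K)) C : 0 <= C ->
  (forall x, rnorm (T x) ^+ 2 <= C ^+ 2 * rnorm x ^+ 2) -> rnorm T <= C.
Proof.
move=> C0 TC; apply: bop_norm_le => // x.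
by rewrite -(@ler_pXn2r _ 2)// ?nnegrE ?mulr_ge0 ?rnorm_ge0// exprMn.
Qed.

Lemma bopBE (S T : 'B(H, K)) x : (S - T) x = S x - T x.
Proof. by []. Qed.

Lemma bop_sumE I (r : seq I) (P : pred I) (F : I -> 'B(H, K)) x :
  (\sum_(i <- r | P i) F i) x = \sum_(i <- r | P i) F i x.
Proof. by elim/big_rec2 : _ => // i y S _ <-. Qed.

End BopNorm.

Section BopComposition.
Variables (R : realType) (H K L : hilbertType R).

Lemma bcompE (S : 'B(K, L)) (T : 'B(H, K)) x : (S \ob T) x = S (T x).
Proof. by []. Qed.

Lemma bcomp_norm (S : 'B(K, L)) (T : 'B(H, K)) :
  rnorm (S \ob T) <= rnorm S * rnorm T.
Proof.
apply: bop_norm_le => [|x]; first by rewrite mulr_ge0 ?rnorm_ge0.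
by rewrite bcompE (le_trans (bop_le _ _))// -mulrA ler_wpM2l ?rnorm_ge0 ?bop_le.
Qed.

Lemma bcompDl (S S' : 'B(K, L)) (T : 'B(H, K)) :
  (S + S') \ob T = S \ob T + S' \ob T.
Proof. exact: bop_ext. Qed.

Lemma bcompBl (S S' : 'B(K, L)) (T : 'B(H, K)) :
  (S - S') \ob T = S \ob T - S' \ob T.
Proof. exact: bop_ext. Qed.

Lemma bcompZl c (S : 'B(K, L)) (T : 'B(H, K)) : (c *: S) \ob T = c *: (S \ob T).
Proof. exact: bop_ext. Qed.

Lemma bcompDr (S : 'B(K, L)) (T T' : 'B(H, K)) :
  S \ob (T + T') = S \ob T + S \ob T'.
Proof. by apply: bop_ext => x; rewrite bopDE !bcompE bopDE linearD. Qed.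

Lemma bcompBr (S : 'B(K, L)) (T T' : 'B(H, K)) :
  S \ob (T - T') = S \ob T - S \ob T'.
Proof. by apply: bop_ext => x; rewrite bopBE !bcompE bopBE linearB. Qed.

Lemma bcompZr c (S : 'B(K, L)) (T : 'B(H, K)) : S \ob (c *: T) = c *: (S \ob T).
Proof. by apply: bop_ext => x; rewrite bopZE !bcompE bopZE linearZ. Qed.

Lemma bcomp0l (T : 'B(H, K)) : (0 : 'B(K, L)) \ob T = 0.
Proof. exact: bop_ext. Qed.

Lemma bcomp0r (S : 'B(K, L)) : S \ob (0 : 'B(H, K)) = 0.
Proof. by apply: bop_ext => x; rewrite bcompE !bop0E linear0. Qed.

Lemma bcomp_suml I (r : seq I) (P : pred I) (F : I -> 'B(K, L)) (T : 'B(H, K)) :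
  (\sum_(i <- r | P i) F i) \ob T = \sum_(i <- r | P i) (F i \ob T).
Proof. by elim/big_rec2 : _ => [|i y S _ <-]; rewrite ?bcomp0l ?bcompDl. Qed.

Lemma bcomp_sumr I (r : seq I) (P : pred I) (S : 'B(K, L)) (F : I -> 'B(H, K)) :
  S \ob (\sum_(i <- r | P i) F i) = \sum_(i <- r | P i) (S \ob F i).
Proof. by elim/big_rec2 : _ => [|i y T _ <-]; rewrite ?bcomp0r ?bcompDr. Qed.

End BopComposition.

Lemma bcompA (R : realType) (H K L P : hilbertType R)
    (S : 'B(L, P)) (T : 'B(K, L)) (U : 'B(H, K)) :
  S \ob (T \ob U) = S \ob T \ob U.
Proof. exact: bop_ext. Qed.

(** * Existence and algebra of adjoints *)

Section AdjointTheory.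
Variables (R : realType) (H K : hilbertType R).
Implicit Types T : 'B(H, K).

(** The imaginary part of [inner u v] is minus the real part of [inner ('i *: u) v], so the real
    form determines the complex one. *)
Lemma inner_rinP (u v : K) (w z : H) :
  rin u v = rin w z -> rin ('i *: u) v = rin ('i *: w) z -> inner u v = inner w z.
Proof.
rewrite /rin !linearZl_LR /=; move: (inner u v) (inner w z) => [a b] [c d] /= ->.
by rewrite !mul0r !mul1r !sub0r => /oppr_inj ->.
Qed.

(** Riesz representation of [x |-> rin (T x) y] gives a vector [S y] for each [y]. Linearity of [S]
    follows from uniqueness of the representing vector, its bound from evaluating at [x = S y], and
    the complex identity from [inner_rinP]. *)
Lemma adj_ex T :
  exists S : 'B(K, H), forall x y, inner (T x) y = inner x (S y).
Proof.
have /choice[S SE] : forall y, exists z, forall x, rin (T x) y = rin x z.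
  move=> y; apply: (@riesz _ _ _ (rnorm T * rnorm y)).
  - by move=> u v; rewrite linearD rinDl.
  - by move=> c u; rewrite linearZ rinZRl.
  - move=> u; apply: (le_trans (rin_le _ _)).
    by rewrite mulrAC ler_wpM2r ?rnorm_ge0 ?bop_le.
have Slin : linear S.
  move=> c y z; apply: rin_inj => x.
  by rewrite -SE rinDr !rinDr !rinZr -!SE linearZ.
have Sbnd y : rnorm (S y) <= rnorm T * rnorm y.
  have [->|Sy0] := eqVneq (rnorm (S y)) 0; first by rewrite mulr_ge0 ?rnorm_ge0.
  have Sy : 0 < rnorm (S y) by rewrite lt_neqAle eq_sym Sy0 rnorm_ge0.
  rewrite -(ler_pM2r Sy) -expr2 -rinxx -SE mulrAC.
  by rewrite (le_trans (rin_le _ _))// ler_wpM2r ?rnorm_ge0 ?bop_le.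
pose S' : {linear K -> H} := HB.pack S (GRing.isLinear.Build _ _ _ _ S Slin).
have Scont : continuous S.
  apply: (@linear_bounded_continuous _ _ _ S').1; apply/linear_boundedP.
  near=> M => y; rewrite -!rnormE.
  have M0 : 0 < M by near: M; exact: nbhs_pinfty_gt.
  rewrite (gt0_RR M0) -rmorphM/= lecR (le_trans (Sbnd y))//.
  rewrite ler_wpM2r ?rnorm_ge0// -lecR -(gt0_RR M0) rnormE.
  by near: M; apply: nbhs_pinfty_ge; exact: normr_real.
have SP : S \in @bounded_linear R K H by apply/asboolP; split.
exists (Bop SP) => x y; apply: inner_rinP; first exact: SE.
by rewrite -linearZ; exact: SE.
Unshelve. all: by end_near. Qed.

Lemma inner_adj T x y : inner (T x) y = inner x (adj T y).
Proof. exact: (getPex (adj_ex T)). Qed.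

Lemma rin_adj T x y : rin (T x) y = rin x (adj T y).
Proof. by rewrite /rin inner_adj. Qed.

Lemma adj_uniq T (S : 'B(K, H)) :
  (forall x y, rin (T x) y = rin x (S y)) -> adj T = S.
Proof.
by move=> TS; apply: bop_ext => y; apply: rin_inj => x; rewrite -rin_adj.
Qed.

End AdjointTheory.

Section AdjointAlgebra.
Variables (R : realType) (H K L : hilbertType R).

Lemma adjK (T : 'B(H, K)) : adj (adj T) = T.
Proof. by apply: adj_uniq => x y; rewrite rinC -rin_adj rinC. Qed.

Lemma adjZD c (S T : 'B(H, K)) : adj (c *: S + T) = Num.conj c *: adj S + adj T.
Proof.
apply: adj_uniq => x y; rewrite !bopDE rinDl rinDr !bopZE (rin_adj T).
by rewrite rinZr conjCK -(rin_adj S) linearZ.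
Qed.

Lemma adjB (S T : 'B(H, K)) : adj (S - T) = adj S - adj T.
Proof.
by apply: adj_uniq => x y; rewrite !bopBE rinBl rinBr !rin_adj.
Qed.

Lemma adj0 : adj (0 : 'B(H, K)) = 0.
Proof. by apply: adj_uniq => x y; rewrite !bop0E rin0l rin0r. Qed.

Lemma adjD (S T : 'B(H, K)) : adj (S + T) = adj S + adj T.
Proof. by apply: adj_uniq => x y; rewrite !bopDE rinDl rinDr !rin_adj. Qed.

Lemma adj_sum I (r : seq I) (P : pred I) (F : I -> 'B(H, K)) :
  adj (\sum_(i <- r | P i) F i) = \sum_(i <- r | P i) adj (F i).
Proof. by elim/big_rec2 : _ => [|i y T _ <-]; rewrite ?adj0 ?adjD. Qed.

Lemma adjM (S : 'B(K, L)) (T : 'B(H, K)) : adj (S \ob T) = adj T \ob adj S.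
Proof. by apply: adj_uniq => x y; rewrite !bcompE !rin_adj. Qed.

Lemma rnorm_adj_le (T : 'B(H, K)) : rnorm (adj T) <= rnorm T.
Proof.
apply: bop_norm_le => [|y]; first exact: rnorm_ge0.
have [->|Sy0] := eqVneq (rnorm (adj T y)) 0; first by rewrite mulr_ge0 ?rnorm_ge0.
have Sy : 0 < rnorm (adj T y) by rewrite lt_neqAle eq_sym Sy0 rnorm_ge0.
rewrite -(ler_pM2r Sy) -expr2 -rinxx -rin_adj mulrAC.
by rewrite (le_trans (rin_le _ _))// ler_wpM2r ?rnorm_ge0 ?bop_le.
Qed.

End AdjointAlgebra.

Lemma rnorm_adj (R : realType) (H K : hilbertType R) (T : 'B(H, K)) :
  rnorm (adj T) = rnorm T.
Proof.
apply/eqP; rewrite eq_le rnorm_adj_le -[in leLHS](adjK T).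
exact: rnorm_adj_le.
Qed.

(** * Closed spans of products and adjoints *)

Section ClosedSpan.
Variables (R : realType) (H K : hilbertType R).
Implicit Types (X P : set 'B(H, K)) (S T : 'B(H, K)).

Lemma sub_span X : X `<=` Defs.span X.
Proof.
move=> T XT; exists 1%N, (fun=> 1), (fun=> T); split=> //.
by rewrite big_ord1 scale1r.
Qed.

Lemma subspace_span X : Defs.subspace (Defs.span X).
Proof.
split=> [|c _ _ [n [d [s [Xs ->]]]] [m [e [t [Xt ->]]]]].
  by exists 0%N, (fun=> 0), (fun=> 0); split=> [[]//|]; rewrite big_ord0.
exists (n + m)%N,
  (fun i => match fintype.split i with inl j => c * d j | inr j => e j end),
  (fun i => match fintype.split i with inl j => s j | inr j => t j end).
split=> [i|]; first by case: fintype.split.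
rewrite big_split_ord/= scaler_sumr; congr (_ + _); apply: eq_bigr => i _.
- by rewrite (unsplitK (inl i)) scalerA.
- by rewrite (unsplitK (inr i)).
Qed.

Lemma subspace_sum P I (r : seq I) (Q : pred I) (F : I -> 'B(H, K)) :
  Defs.subspace P -> (forall i, Q i -> P (F i)) -> P (\sum_(i <- r | Q i) F i).
Proof.
by move=> [P0 PD] PF; elim/big_ind : _ => // S T PS PT; rewrite -[S]scale1r; exact: PD.
Qed.

Lemma subspaceB P S T : Defs.subspace P -> P S -> P T -> P (S - T).
Proof. by move=> [_ PD] PS PT; rewrite addrC -scaleN1r; exact: PD. Qed.

Lemma subspace_closure P : Defs.subspace P -> Defs.subspace (closure P).
Proof.
move=> [P0 PD]; split=> [|c S T /closure_rnormP cS /closure_rnormP cT].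
  exact: subset_closure.
apply/closure_rnormP => e e0.
(* The summand 1 keeps the divisor positive even if [c] is 0; the same device recurs in later
   estimates. *)
pose C := complex.Re `|c| + 1.
have c0 : 0 <= complex.Re `|c| by rewrite -lecR RRe_real ?normr_real// normr_ge0.
have C0 : 0 < C by rewrite ltr_wpDl.
have e1 : 0 < e / 2 / C by rewrite !divr_gt0.
have e2 : 0 < e / 2 by rewrite divr_gt0.
have [S' PS'] := cS _ e1; rewrite ltr_pdivlMr// => SS'.
have [T' PT' TT'] := cT _ e2.
exists (c *: S' + T'); first exact: PD.
rewrite opprD addrACA -scalerBr (le_lt_trans (rnormD _ _))//.
rewrite [ltRHS](_ : _ = e / 2 + e / 2); last by field.
rewrite ler_ltD// rnormZ (le_trans _ (ltW SS'))// mulrC.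
by rewrite ler_wpM2l ?rnorm_ge0// lerDl.
Qed.

Lemma sub_clspan X : X `<=` clspan X.
Proof. by move=> T XT; apply: subset_closure; exact: sub_span. Qed.

Lemma clspan_operator_space X : operator_space (clspan X).
Proof.
by split; [exact/subspace_closure/subspace_span|exact: closed_closure].
Qed.

(** The universal property of the closed span: inclusions of closed spans in operator spaces are
    checked on generators. *)
Lemma clspan_min X P : operator_space P -> X `<=` P -> clspan X `<=` P.
Proof.
move=> [sP cP] XP; apply: subset_trans cP; apply: closure_subset.
move=> _ [n [c [s [Xs ->]]]]; apply: subspace_sum => // i _.
by have [P0 PD] := sP; rewrite -[_ *: _]addr0; apply: PD => //; exact/XP/Xs.
Qed.

Lemma clspan_id P : operator_space P -> clspan P = P.
Proof.
by move=> PP; apply/seteqP; split; [exact: clspan_min|exact: sub_clspan].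
Qed.

Lemma eq_clspan X P : X `<=` clspan P -> P `<=` clspan X -> clspan X = clspan P.
Proof.
move=> XP PX; apply/seteqP; split;
  by apply: clspan_min => //; exact: clspan_operator_space.
Qed.

End ClosedSpan.

Section Preimage.
Variables (R : realType) (H K H' K' : hilbertType R).

(** The parameter [th] is the identity for composition with a fixed operator and conjugation for
    [adj]. Together with [clspan_min] this extends a membership from generators to a whole closed
    span. *)
Lemma preimage_operator_space (f : 'B(H, K) -> 'B(H', K')) (th : R[i] -> R[i])
    (C : R) (P : set 'B(H', K')) :
  (forall c S T, f (c *: S + T) = th c *: f S + f T) ->
  (forall T, rnorm (f T) <= C * rnorm T) ->
  operator_space P -> operator_space (f @^-1` P).
Proof.
move=> fD fC [[P0 PD] cP].
have fB S T : f (S - T) = f S - f T.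
  have f0 : f 0 = 0.
    apply: rnorm_eq0; apply/eqP; rewrite eq_le rnorm_ge0 andbT.
    by rewrite (le_trans (fC _))// rnorm0 mulr0.
  (* The value of [th 1] is unknown, but [c = 1] with a zero second argument shows that [th 1] acts
     as 1 on the image of [f]. *)
  have fA U V : f (U + V) = f U + f V.
    have fU : f U = th 1 *: f U by have := fD 1 U 0; rewrite scale1r addr0 f0 addr0.
    by rewrite [in RHS]fU -fD scale1r.
  apply/eqP; rewrite eq_sym subr_eq -fA subrK//.
split; first split=> [|c S T /= PS PT].
- have := fB 0 0; rewrite !subrr /preimage/= => ->; exact: P0.
- by rewrite fD; exact: PD.
move=> T /closure_rnormP cT; apply: cP; apply/closure_rnormP => e e0.
have C0 : 0 < `|C| + 1 by rewrite ltr_wpDl.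
have e1 : 0 < e / (`|C| + 1) by rewrite divr_gt0.
have [S PS] := cT _ e1; rewrite ltr_pdivlMr// => TS.
exists (f S) => //; rewrite -fB (le_lt_trans (fC _))//.
rewrite (le_lt_trans _ TS)// mulrC ler_wpM2l ?rnorm_ge0//.
by rewrite (le_trans (ler_norm _))// lerDl.
Qed.

End Preimage.

Section Products.
Variables (R : realType) (H K L : hilbertType R).
Implicit Types (X : set 'B(K, L)) (Y : set 'B(H, K)).

Lemma mem_prodset X Y S T : X S -> Y T -> (X ** Y) (S \ob T).
Proof. by exists S => //; exists T. Qed.

Lemma prodsetP X Y (P : set 'B(H, L)) :
  (forall S T, X S -> Y T -> P (S \ob T)) -> X ** Y `<=` P.
Proof. by move=> XY _ [S XS [T YT <-]]; exact: XY. Qed.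

Lemma prodset_sub X X' Y Y' : X `<=` X' -> Y `<=` Y' -> X ** Y `<=` X' ** Y'.
Proof.
by move=> XX YY; apply: prodsetP => S T /XX ? /YY ?; exact: mem_prodset.
Qed.

Lemma preim_compl (S : 'B(K, L)) (P : set 'B(H, L)) :
  operator_space P -> operator_space [set T | P (S \ob T)].
Proof.
apply: (@preimage_operator_space _ _ _ _ _ (fun T => S \ob T) id (rnorm S)) => [c T U|T].
  by rewrite bcompDr bcompZr.
exact: bcomp_norm.
Qed.

Lemma preim_compr (T : 'B(H, K)) (P : set 'B(H, L)) :
  operator_space P -> operator_space [set S | P (S \ob T)].
Proof.
apply: (@preimage_operator_space _ _ _ _ _ (fun S => S \ob T) id (rnorm T)) => [c S U|S].
  by rewrite bcompDl bcompZl.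
by rewrite mulrC; exact: bcomp_norm.
Qed.

Lemma clspan_prodl X Y (P : set 'B(H, L)) : operator_space P ->
  X ** Y `<=` P -> clspan X ** Y `<=` P.
Proof.
move=> PP XYP; apply: prodsetP => S T XS YT; move: S XS.
apply: (clspan_min (preim_compr T PP)) => S XS /=.
exact/XYP/mem_prodset.
Qed.

Lemma clspan_prodr X Y (P : set 'B(H, L)) : operator_space P ->
  X ** Y `<=` P -> X ** clspan Y `<=` P.
Proof.
move=> PP XYP; apply: prodsetP => S T XS YT; move: T YT.
apply: (clspan_min (preim_compl S PP)) => T YT /=.
exact/XYP/mem_prodset.
Qed.

(** Inner closures may be inserted or erased; with [prodsetA] this makes the calculus of closed
    spans of products associative. *)
Lemma clspan_clspanl X Y : clspan (clspan X ** Y) = clspan (X ** Y).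
Proof.
apply: eq_clspan.
  by apply: clspan_prodl; [exact: clspan_operator_space|exact: sub_clspan].
apply: subset_trans (@sub_clspan _ _ _ _).
by apply: prodset_sub => //; exact: sub_clspan.
Qed.

Lemma clspan_clspanr X Y : clspan (X ** clspan Y) = clspan (X ** Y).
Proof.
apply: eq_clspan.
  by apply: clspan_prodr; [exact: clspan_operator_space|exact: sub_clspan].
apply: subset_trans (@sub_clspan _ _ _ _).
by apply: prodset_sub => //; exact: sub_clspan.
Qed.

End Products.

Lemma prodsetA (R : realType) (H K L P : hilbertType R)
    (X : set 'B(L, P)) (Y : set 'B(K, L)) (Z : set 'B(H, K)) :
  X ** (Y ** Z) = X ** Y ** Z.
Proof.
apply/seteqP; split=> [_ [S XS [_ [T YT [U ZU <-]] <-]]|_ [_ [S XS [T YT <-]] [U ZU <-]]].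
- by rewrite bcompA; apply: mem_prodset => //; exact: mem_prodset.
- by rewrite -bcompA; apply: mem_prodset => //; exact: mem_prodset.
Qed.

Lemma mem_adjset (R : realType) (H K : hilbertType R) (X : set 'B(H, K)) T :
  X T -> X^⋆ (adj T).
Proof. by exists T. Qed.

Lemma adjset_prod (R : realType) (H K L : hilbertType R) (X : set 'B(K, L))
    (Y : set 'B(H, K)) :
  (X ** Y)^⋆ = Y^⋆ ** X^⋆.
Proof.
apply/seteqP; split=> [_ [_ [S XS [T YT <-]] <-]|_ [_ [S XS <-] [_ [T YT <-] <-]]].
- by rewrite adjM; apply: mem_prodset; exact: mem_adjset.
- by rewrite -adjM; apply: mem_adjset; exact: mem_prodset.
Qed.

Lemma adjsetK (R : realType) (H K : hilbertType R) (X : set 'B(H, K)) :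
  X^⋆^⋆ = X.
Proof.
apply/seteqP; split=> [_ [_ [S XS <-] <-]|S XS]; first by rewrite adjK.
by rewrite -(adjK S); do 2 apply: mem_adjset.
Qed.

Lemma preim_adj (R : realType) (H K : hilbertType R) (P : set 'B(K, H)) :
  operator_space P -> operator_space [set T : 'B(H, K) | P (adj T)].
Proof.
apply: (@preimage_operator_space _ _ _ _ _ (@adj R H K) (@Num.conj R[i]) 1) => [c S T|T].
  by rewrite adjZD.
by rewrite mul1r rnorm_adj.
Qed.

Lemma adjset_clspan_sub (R : realType) (H K : hilbertType R) (X : set 'B(H, K)) :
  (clspan X)^⋆ `<=` clspan X^⋆.
Proof.
move=> _ [T XT <-]; move: T XT.
apply: (clspan_min (preim_adj (clspan_operator_space _))) => T XT /=.
exact/sub_clspan/mem_adjset.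
Qed.

(** The second inclusion is the first one for the adjoint set, because [adj] is an involution. *)
Lemma adjset_clspan (R : realType) (H K : hilbertType R) (X : set 'B(H, K)) :
  (clspan X)^⋆ = clspan X^⋆.
Proof.
apply/seteqP; split; first exact: adjset_clspan_sub.
move=> T XT; rewrite -(adjK T); apply: mem_adjset; rewrite -[X]adjsetK.
exact/adjset_clspan_sub/mem_adjset.
Qed.

(** * Contractions acting as approximate units *)

(** Since the maps [f i] are uniformly contractive, pointwise convergence to the identity passes to
    closures by an [e / 3] argument. *)
Lemma fixed_operator_space (R : realType) (H K : hilbertType R) (I : Type)
    (F : set_system I) {FF : Filter F} (f : I -> 'B(H, K) -> 'B(H, K)) :
  (forall i, linear (f i)) -> (forall i T, rnorm (f i T) <= rnorm T) ->
  operator_space [set T | forall e : R, 0 < e -> \forall i \near F, rnorm (f i T - T) < e].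
Proof.
move=> fL fC.
have fB i S T : f i (S - T) = f i S - f i T.
  have -> : S - T = -1 *: T + S by rewrite scaleN1r addrC.
  by rewrite fL scaleN1r addrC.
split; first split=> [e e0|c S T fS fT e e0].
- apply: nearW => i; have := fB i 0 0; rewrite !subrr => ->.
  by rewrite subrr rnorm0.
- pose C := complex.Re `|c| + 1.
  have c0 : 0 <= complex.Re `|c| by rewrite -lecR RRe_real ?normr_real// normr_ge0.
  have C0 : 0 < C by rewrite ltr_wpDl.
  have e1 : 0 < e / 2 / C by rewrite !divr_gt0.
  have e2 : 0 < e / 2 by rewrite divr_gt0.
  near=> i.
  rewrite fL opprD addrACA -scalerBr (le_lt_trans (rnormD _ _))//.
  rewrite [ltRHS](_ : _ = e / 2 + e / 2); last by field.
  rewrite ler_ltD//; last by near: i; exact: fT.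
  have : rnorm (f i S - S) < e / 2 / C by near: i; exact: fS.
  rewrite ltr_pdivlMr// rnormZ => /ltW; apply: le_trans.
  by rewrite mulrC ler_wpM2l ?rnorm_ge0// lerDl.
- move=> T /closure_rnormP cT e e0.
  have e3 : 0 < e / 3 by rewrite divr_gt0.
  have [S fS TS] := cT _ e3; have := fS _ e3; apply: filterS => i iS.
  rewrite (le_lt_trans (rnorm_triangle (f i S) _ _))// -fB.
  have := fC i (T - S); have := rnorm_triangle S (f i S) T.
  rewrite (rdistC S T); move: iS TS.
  move: (rnorm (f i S - T)) (rnorm (f i S - S)) (rnorm (T - S)) (rnorm (f i (T - S))).
  by move=> p q r s; lra.
Unshelve. all: by end_near. Qed.

Section FixedOperators.
Variables (R : realType) (H K : hilbertType R) (I : Type) (F : set_system I).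

(** A filter treats two cases alike: [\oo] for the sequences of a sigma-TRO, and the tails of a net
    for an approximate identity. *)
Definition left_fixed (e : I -> 'B(K, K)) : set 'B(H, K) :=
  [set T | forall c : R, 0 < c -> \forall i \near F, rnorm (e i \ob T - T) < c].

Definition right_fixed (e : I -> 'B(H, H)) : set 'B(H, K) :=
  [set T | forall c : R, 0 < c -> \forall i \near F, rnorm (T \ob e i - T) < c].

End FixedOperators.

(** With [u = x h] and [t] a contraction, [|t^* u - u|^2] is at most [2 |u|^2 - 2 Re <t u, u>], that
    is [2 Re <u - t u, u>], and Cauchy-Schwarz finishes. *)
Lemma contraction_adj (R : realType) (H K : hilbertType R) (t : 'B(K, K))
    (x : 'B(H, K)) (c : R) : rnorm t <= 1 -> 0 <= c ->
  2 * rnorm x * rnorm (t \ob x - x) <= c ^+ 2 -> rnorm (adj t \ob x - x) <= c.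
Proof.
move=> t1 c0 tc; apply: bop_norm_sqr_le => // h.
apply: le_trans (ler_wpM2r (sqr_ge0 (rnorm h)) tc).
rewrite bopBE bcompE; set u := x h.
have tu : rin (adj t u) u = rin (t u) u by rewrite (rin_adj t) rinC.
have u2 : rnorm (adj t u) ^+ 2 <= rnorm u ^+ 2.
  rewrite ler_pXn2r ?nnegrE ?rnorm_ge0// (le_trans (bop_le _ _))// rnorm_adj.
  by rewrite -[leRHS]mul1r ler_wpM2r ?rnorm_ge0.
have d1 : rnorm (u - t u) * rnorm u <=
    (rnorm (t \ob x - x) * rnorm h) * (rnorm x * rnorm h).
  by rewrite ler_pM ?rnorm_ge0 ?bop_le// rdistC; exact: (bop_le (t \ob x - x)).
have d2 := rin_le (u - t u) u; rewrite rinBl rinxx in d2.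
rewrite rnorm_sqrB tu; move: d1; rewrite mulrACA -expr2 => d1.
by lra.
Qed.

Section ContractionNets.
Variables (R : realType) (H K : hilbertType R) (I : Type).
Variables (F : set_system I) (FF : Filter F) (e : I -> 'B(K, K)).
Hypothesis e_le1 : forall i, rnorm (e i) <= 1.

Lemma left_fixed_operator_space : operator_space (@left_fixed R H K I F e).
Proof.
apply: fixed_operator_space => [i c S T|i T]; first by rewrite bcompDr bcompZr.
rewrite (le_trans (bcomp_norm _ _))// -[leRHS]mul1r.
by rewrite ler_wpM2r ?rnorm_ge0.
Qed.

Lemma right_fixed_operator_space : operator_space (@right_fixed R K H I F e).
Proof.
apply: fixed_operator_space => [i c S T|i T]; first by rewrite bcompDl bcompZl.
rewrite (le_trans (bcomp_norm _ _))// -[leRHS]mulr1.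
by rewrite ler_wpM2l ?rnorm_ge0.
Qed.

Lemma left_fixed_adj (x : 'B(H, K)) :
  left_fixed F e x -> left_fixed F (fun i => adj (e i)) x.
Proof.
move=> ex c c0; have c2 : 0 < c / 2 by rewrite divr_gt0.
have x1 : 0 < 2 * rnorm x + 1 by rewrite ltr_wpDl ?mulr_ge0 ?rnorm_ge0.
(* The estimate of [contraction_adj] bounds a squared norm, hence the square; halving [c] restores a
   strict inequality at the end. *)
have c1 : 0 < (c / 2) ^+ 2 / (2 * rnorm x + 1) by rewrite divr_gt0 ?exprn_gt0.
apply: filterS (ex _ c1) => i; rewrite ltr_pdivlMr// => /ltW ei.
apply: le_lt_trans (_ : c / 2 < c); last by rewrite ltr_pdivrMr// ltr_pMr// ltr1n.
apply: contraction_adj; rewrite ?(ltW c2)//; apply: le_trans ei.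
by rewrite mulrC ler_wpM2l ?rnorm_ge0// lerDl.
Qed.

Lemma left_fixedM (L : hilbertType R) (x : 'B(H, K)) (y : 'B(L, H)) :
  left_fixed F e x -> left_fixed F e (x \ob y).
Proof.
move=> ex c c0; have y1 : 0 < rnorm y + 1 by rewrite ltr_wpDl ?rnorm_ge0.
have c1 : 0 < c / (rnorm y + 1) by rewrite divr_gt0.
apply: filterS (ex _ c1) => k; rewrite ltr_pdivlMr//.
apply: le_lt_trans; rewrite bcompA -bcompBl (le_trans (bcomp_norm _ _))//.
by rewrite ler_wpM2l ?rnorm_ge0// lerDl.
Qed.

Lemma right_fixedM (L : hilbertType R) (x : 'B(K, H)) (y : 'B(H, L)) :
  right_fixed F e x -> right_fixed F e (y \ob x).
Proof.
move=> ex c c0; have y1 : 0 < rnorm y + 1 by rewrite ltr_wpDl ?rnorm_ge0.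
have c1 : 0 < c / (rnorm y + 1) by rewrite divr_gt0.
apply: filterS (ex _ c1) => k; rewrite ltr_pdivlMr// mulrC.
apply: le_lt_trans; rewrite -bcompA -bcompBr (le_trans (bcomp_norm _ _))//.
by rewrite ler_wpM2r ?rnorm_ge0// lerDl.
Qed.

End ContractionNets.

Lemma left_fixed_adjP (R : realType) (H K : hilbertType R) (I : Type) (F : set_system I)
    (FF : Filter F) (e : I -> 'B(K, K)) (x : 'B(K, H)) :
  right_fixed F e x <-> left_fixed F (fun i => adj (e i)) (adj x).
Proof.
by split=> ex c c0; apply: filterS (ex _ c0) => i; rewrite -adjM -adjB rnorm_adj.
Qed.

(** * Double sums along an enumeration of pairs *)

Lemma ler_sum_uniq_subset (R : realDomainType) (T : eqType) (s t : seq T) (g : T -> R) :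
  (forall p, 0 <= g p) -> uniq s -> uniq t -> {subset s <= t} ->
  \sum_(p <- s) g p <= \sum_(p <- t) g p.
Proof.
move=> g0 us ut st; rewrite [leRHS](bigID (mem s))/=.
rewrite -[leLHS]addr0 lerD//; last exact: sumr_ge0.
rewrite -[leRHS]big_filter (@perm_big _ _ _ _ s [seq p <- t | p \in s])//.
apply: uniq_perm => //; first exact: filter_uniq.
by move=> p; rewrite mem_filter; case: (boolP (p \in s)) => //= /st ->.
Qed.

Section PairEnumeration.
Variables (R : realDomainType).
Implicit Types g : nat * nat -> R.

(** A natural number that codes no pair is sent to [None] and contributes 0 to the sums. *)
Let pinv : nat -> option (nat * nat) := @pickle_inv (nat * nat)%type.

Let sum_pmap g N :
  \sum_(0 <= k < N) oapp g 0 (pinv k) = \sum_(p <- pmap pinv (iota 0 N)) g p.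
Proof. by rewrite big_pmap /index_iota subn0; apply: eq_bigr. Qed.

Let pairs I J := [seq (i, j) | j <- iota 0 J, i <- iota 0 I].

Let sum_pairs g I J :
  \sum_(0 <= j < J) \sum_(0 <= i < I) g (i, j) = \sum_(p <- pairs I J) g p.
Proof. by rewrite big_allpairs_dep /index_iota !subn0. Qed.

Let uniq_pairs I J : uniq (pairs I J).
Proof.
apply: allpairs_uniq; rewrite ?iota_uniq//.
by move=> [j i] [j' i'] _ _ /= [-> ->].
Qed.

Let uniq_pmap N : uniq (pmap pinv (iota 0 N)).
Proof. exact/(pmap_uniq (@pickle_invK _))/iota_uniq. Qed.

(** The finitely many pairs with code below [N] lie in a rectangle, and the terms are
    nonnegative. *)
Lemma sum_enum_le N : exists I J, forall g, (forall p, 0 <= g p) ->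
  \sum_(0 <= k < N) oapp g 0 (pinv k) <=
  \sum_(0 <= j < J) \sum_(0 <= i < I) g (i, j).
Proof.
set s := pmap pinv (iota 0 N).
exists (\max_(p <- s) p.1).+1, (\max_(p <- s) p.2).+1 => g g0.
rewrite sum_pmap sum_pairs; apply: ler_sum_uniq_subset => //.
move=> [i j] ijs; apply/allpairsP; exists (j, i); split=> //.
- rewrite mem_iota leq0n add0n ltnS.
  exact: (@leq_bigmax_seq _ s xpredT (fun p => p.2) (i, j)).
- rewrite mem_iota leq0n add0n ltnS.
  exact: (@leq_bigmax_seq _ s xpredT (fun p => p.1) (i, j)).
Qed.

(** A rectangle has a largest code. The threshold [N0] is chosen before [g], so it serves all
    vectors at once in an operator norm estimate. *)
Lemma le_sum_enum I J : exists N0, forall N, (N0 <= N)%N ->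
  forall g, (forall p, 0 <= g p) ->
  \sum_(0 <= j < J) \sum_(0 <= i < I) g (i, j) <=
  \sum_(0 <= k < N) oapp g 0 (pinv k).
Proof.
exists (\max_(p <- pairs I J) pickle p).+1 => N NN g g0.
rewrite sum_pmap sum_pairs; apply: ler_sum_uniq_subset => //.
move=> p pIJ; rewrite mem_pmap.
apply/mapP; exists (pickle p); last by rewrite /pinv pickleK_inv.
rewrite mem_iota leq0n add0n (leq_trans _ NN)// ltnS.
exact: (@leq_bigmax_seq _ _ xpredT pickle).
Qed.

End PairEnumeration.

(** * Gram operators and their defect *)

Section Gram.
Variables (R : realType) (H K : hilbertType R) (I : Type).
Variables (s : seq I) (u : I -> 'B(H, K)).

(** This is [u^* u] for the column operator with entries [u i]. Both sums in the definition of a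
    sigma-TRO have this form, with entries [n_j] and [m_i^*] respectively. *)
Definition gram : 'B(H, H) := \sum_(i <- s) (adj (u i) \ob u i).

Lemma rin_gram x y : rin (gram x) y = \sum_(i <- s) rin (u i x) (u i y).
Proof.
rewrite bop_sumE rin_suml; apply: eq_bigr => i _.
by rewrite bcompE rinC -rin_adj rinC.
Qed.

Lemma rin_gramxx x : rin (gram x) x = \sum_(i <- s) rnorm (u i x) ^+ 2.
Proof. by rewrite rin_gram; apply: eq_bigr => i _; rewrite rinxx. Qed.

Lemma adj_gram : adj gram = gram.
Proof. by rewrite adj_sum; apply: eq_bigr => i _; rewrite adjM adjK. Qed.

Lemma gram_amgm x y : 2 * rin (gram x) y <= rin (gram x) x + rin (gram y) y.
Proof.
rewrite rin_gram !rin_gramxx mulr_sumr -big_split/=.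
by apply: ler_sum => i _; exact: rin_amgm.
Qed.

(** Writing [G] for [gram], [gram_amgm] at [y = G x] gives [2 |G x|^2 <= <G x, x> + <G G x, G x>],
    which the hypothesis bounds by [|x|^2 + |G x|^2]. *)
Lemma gram_le1 : (forall x, \sum_(i <- s) rnorm (u i x) ^+ 2 <= rnorm x ^+ 2) ->
  rnorm gram <= 1.
Proof.
move=> u1; apply: bop_norm_sqr_le => // x; rewrite expr1n mul1r.
have := gram_amgm x (gram x); have := u1 x; have := u1 (gram x).
by rewrite -!rin_gramxx rinxx; lra.
Qed.

Lemma gram_le x : rnorm gram <= 1 ->
  \sum_(i <- s) rnorm (u i x) ^+ 2 <= rnorm x ^+ 2.
Proof.
move=> g1; rewrite -rin_gramxx (le_trans (rin_le _ _))// expr2.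
rewrite ler_wpM2r ?rnorm_ge0// (le_trans (bop_le _ _))//.
by rewrite -[leRHS]mul1r ler_wpM2r ?rnorm_ge0.
Qed.

(** This is [(1 - G)^2 <= 1 - G] for a positive contraction [G]. It amounts to
    [|G x|^2 <= <G x, x>], which again comes from [gram_amgm] at [G x]. *)
Lemma gram_defect x : rnorm gram <= 1 ->
  rnorm (x - gram x) ^+ 2 <= rnorm x ^+ 2 - \sum_(i <- s) rnorm (u i x) ^+ 2.
Proof.
move=> g1; rewrite rnorm_sqrB -rin_gramxx (rinC x).
have := gram_amgm x (gram x); rewrite rinxx.
by have := gram_le (gram x) g1; rewrite -rin_gramxx; lra.
Qed.

(** The left side is [<T x - G T x, T x>]. This passes from norm approximation to quadratic forms,
    and [gram_defect] goes back. *)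
Lemma gram_near (L : hilbertType R) (T : 'B(L, H)) x :
  rnorm (T x) ^+ 2 - \sum_(i <- s) rnorm (u i (T x)) ^+ 2 <=
  rnorm (T - gram \ob T) * rnorm T * rnorm x ^+ 2.
Proof.
rewrite -rin_gramxx -rinxx -rinBl (le_trans (rin_le _ _))//.
rewrite expr2 mulrACA ler_pM ?rnorm_ge0 ?bop_le//.
exact: (bop_le (T - gram \ob T)).
Qed.

End Gram.

Lemma near_small_sum (R : realType) (a : nat -> nat -> R) J :
  (forall j (e : R), 0 < e -> \forall i \near \oo, a j i < e) ->
  forall e : R, 0 < e -> \forall i \near \oo, \sum_(0 <= j < J) a j i < e.
Proof.
move=> a0; elim: J => [|J IH] e e0; first by apply: nearW => i; rewrite big_nil.
have e2 : 0 < e / 2 by rewrite divr_gt0.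
near=> i; rewrite big_nat_recr//=.
rewrite [ltRHS](_ : _ = e / 2 + e / 2); last by field.
by apply: ltrD; near: i; [exact: IH|exact: a0].
Unshelve. all: by end_near. Qed.

(** * The C*-algebra generated by a sigma-TRO *)

Section SupportAlgebra.
Variables (R : realType) (H K : hilbertType R) (M : set 'B(H, K)).
Hypothesis TROM : TRO M.

Let Q := M^⋆ ** M.

Lemma adjset_support : Q^⋆ = Q.
Proof. by rewrite adjset_prod adjsetK. Qed.

Lemma adjset_clspan_support : (clspan Q)^⋆ = clspan Q.
Proof. by rewrite adjset_clspan adjset_support. Qed.

Lemma support_mul : Q ** Q `<=` Q.
Proof.
rewrite prodsetA -!(prodsetA M^⋆); apply: prodset_sub => //.
exact: (proj2 TROM).
Qed.

Lemma clspan_support_mul : clspan Q ** clspan Q `<=` clspan Q.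
Proof.
apply: clspan_prodl; first exact: clspan_operator_space.
apply: clspan_prodr; first exact: clspan_operator_space.
exact: subset_trans support_mul (@sub_clspan _ _ _ _).
Qed.

End SupportAlgebra.

Section SupportSigmaTRO.
Variables (R : realType) (H K : hilbertType R) (M : set 'B(H, K)).
Variables m n : nat -> 'B(H, K).
Hypothesis Mn : forall i, M (m i) /\ M (n i).
Hypothesis m_lim : forall x, M x ->
  \sum_(0 <= i < k) (m i \ob adj (m i) \ob x) @[k --> \oo] --> x.
Hypothesis n_lim : forall x, M x ->
  \sum_(0 <= j < k) (x \ob adj (n j) \ob n j) @[k --> \oo] --> x.
Hypothesis m_le1 : forall k, `|\sum_(0 <= i < k) (m i \ob adj (m i))| <= 1.
Hypothesis n_le1 : forall k, `|\sum_(0 <= j < k) (adj (n j) \ob n j)| <= 1.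

Let Q := M^⋆ ** M.
Let d k := gram (index_iota 0 k) n.
Let d' k := gram (index_iota 0 k) (fun i => adj (m i)).

Lemma ngram_le1 k : rnorm (d k) <= 1.
Proof. by rewrite -norm_leE; exact: n_le1. Qed.

Lemma mgram_le1 k : rnorm (d' k) <= 1.
Proof.
rewrite -norm_leE /d' /gram; under eq_bigr do rewrite adjK; exact: m_le1.
Qed.

Lemma ngram_lim : M `<=` right_fixed \oo d.
Proof.
move=> x Mx e e0; have [N xN] := (cvg_rnormP _ _).1 (n_lim Mx) _ e0.
exists N => // k /xN; rewrite /d /gram bcomp_sumr.
by under eq_bigr do rewrite -bcompA.
Qed.

Lemma mgram_lim : M `<=` left_fixed \oo d'.
Proof.
move=> x Mx e e0; have [N xN] := (cvg_rnormP _ _).1 (m_lim Mx) _ e0.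
exists N => // k /xN; rewrite /d' /gram bcomp_suml.
by under [in X in _ -> X]eq_bigr do rewrite adjK.
Qed.

(* [sum_(i, j) (m_i^* n_j)^* (m_i^* n_j)] tends to [sum_j n_j^* n_j], so the
   elements [m_i^* n_j] of [Q] give an approximate unit without square roots. *)
Let u k := oapp (fun p => adj (m p.1) \ob n p.2) (0 : 'B(H, H))
  (@pickle_inv (nat * nat)%type k).

Let rnorm_u k h : rnorm (u k h) ^+ 2 =
  oapp (fun p => rnorm (adj (m p.1) (n p.2 h)) ^+ 2) 0 (@pickle_inv (nat * nat)%type k).
Proof.
rewrite /u; case: pickle_inv => [//|].
by rewrite /= [X in rnorm X](_ : _ = 0 :> H)// rnorm0 expr0n.
Qed.

Let U k := gram (index_iota 0 k) u.

(** On a rectangle containing the first [k] codes, the sum over [i] of [|m_i^* n_j h|^2] is at most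
    [|n_j h|^2], and the sum of these over [j] is at most [|h|^2]. *)
Let U_le1 k : rnorm (U k) <= 1.
Proof.
apply: gram_le1 => h; under eq_bigr do rewrite rnorm_u.
have [I [J IJ]] := @sum_enum_le R k; apply: le_trans (IJ _ _) _ => [p|/=].
  exact: sqr_ge0.
apply: le_trans (gram_le h (ngram_le1 J)); apply: ler_sum => j _.
exact: (gram_le (n j h) (mgram_le1 I)).
Qed.

(** By [gram_defect] it suffices that [|y h|^2] nearly equals the sum of the [|m_i^* n_j y h|^2].
    First [J] is chosen so that the [|n_j y h|^2] with [j < J] nearly exhaust [|y h|^2], then [I] so
    that the [m_i^*] nearly preserve each of these norms, and then [N0] so that the enumeration
    covers the rectangle. *)
Let U_lim_adj p : M p -> left_fixed \oo U (adj p).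
Proof.
move=> Mp e e0; set y := adj p; set b := rnorm y.
have b0 : 0 <= b by exact: rnorm_ge0.
have b1 : 0 < b + 1 by rewrite ltr_wpDl.
have b2 : 0 < b ^+ 2 + 1 by rewrite ltr_wpDl ?sqr_ge0.
(* Squared norms are compared, so the total error allowed is [(e / 2) ^+ 2]: one half for truncating
   at [J], the other for truncating at [I]. *)
have c0 : 0 < (e / 2) ^+ 2 / 2 by rewrite divr_gt0 ?exprn_gt0 ?divr_gt0.
have e1 : 0 < (e / 2) ^+ 2 / 2 / (b + 1) by rewrite divr_gt0.
have e2 : 0 < (e / 2) ^+ 2 / 2 / (b ^+ 2 + 1) by rewrite divr_gt0.
have [J _ /(_ _ (leqnn J))/=] := ngram_lim Mp e1.
rewrite -rnorm_adj adjB adjM adj_gram rdistC -/y => /ltW.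
rewrite ler_pdivlMr// => yJ.
have [|I _ /(_ _ (leqnn I))/= /ltW] := @near_small_sum R
  (fun j i => rnorm (n j - d' i \ob n j) * rnorm (n j)) J _ _ e2.
  move=> j f f0; have nj1 : 0 < rnorm (n j) + 1 by rewrite ltr_wpDl ?rnorm_ge0.
  have f1 : 0 < f / (rnorm (n j) + 1) by rewrite divr_gt0.
  apply: filterS (mgram_lim (proj2 (Mn j)) f1) => i; rewrite ltr_pdivlMr// rdistC.
  by apply: le_lt_trans; rewrite ler_wpM2l ?rnorm_ge0// lerDl.
rewrite ler_pdivlMr// => nI.
have [N0 N0P] := @le_sum_enum R I J.
exists N0 => // N /= NN; rewrite rdistC.
apply: le_lt_trans (_ : e / 2 < e); last by rewrite ltr_pdivrMr// ltr_pMr// ltr1n.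
apply: bop_norm_sqr_le => [|h]; first by rewrite ltW// divr_gt0.
rewrite bopBE bcompE (le_trans (gram_defect _ (U_le1 N)))//.
under eq_bigr do rewrite rnorm_u.
have := N0P N NN (fun p => rnorm (adj (m p.1) (n p.2 (y h))) ^+ 2) (fun=> sqr_ge0 _).
move=> /=; set S1 := \sum_(0 <= j < J) _; set S2 := \sum_(0 <= k < N) _ => S12.
have A := gram_near (index_iota 0 J) n y h; rewrite -/(d J) -/b in A.
set S3 := \sum_(i <- _) _ in A.
have B : S3 - S1 <=
    (\sum_(0 <= j < J) rnorm (n j - d' I \ob n j) * rnorm (n j)) * (b ^+ 2 * rnorm h ^+ 2).
  rewrite /S3 /S1 -sumrB mulr_suml; apply: ler_sum => j _.
  apply: le_trans (gram_near (index_iota 0 I) (fun i => adj (m i)) (n j) (y h)) _.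
  rewrite ler_wpM2l ?mulr_ge0 ?rnorm_ge0// -exprMn.
  by rewrite ler_pXn2r ?nnegrE ?mulr_ge0 ?rnorm_ge0 ?bop_le.
have h0 := sqr_ge0 (rnorm h).
set s := rnorm (y - d J \ob y) in A yJ; set t := \sum_(0 <= j < J) _ in B nI.
have s0 : 0 <= s by exact: rnorm_ge0.
have t0 : 0 <= t by apply: sumr_ge0 => j _; rewrite mulr_ge0 ?rnorm_ge0.
have Ah : s * b * rnorm h ^+ 2 <= (e / 2) ^+ 2 / 2 * rnorm h ^+ 2.
  by rewrite ler_wpM2r// (le_trans _ yJ)// ler_wpM2l// lerDl.
have Bh : t * (b ^+ 2 * rnorm h ^+ 2) <= (e / 2) ^+ 2 / 2 * rnorm h ^+ 2.
  by rewrite mulrA ler_wpM2r// (le_trans _ nI)// ler_wpM2l// lerDl.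
move: A B Ah Bh S12; set c := (e / 2) ^+ 2; set h2 := rnorm h ^+ 2.
by lra.
Qed.

Let U_lim : clspan Q `<=` left_fixed \oo U.
Proof.
apply: (clspan_min (@left_fixed_operator_space _ H _ _ _ _ _ U_le1)).
by apply: prodsetP => _ q [p Mp <-] Mq; apply: left_fixedM; exact: U_lim_adj.
Qed.

Let Qu k : clspan Q (u k).
Proof.
have [[Q0 _] _] := clspan_operator_space Q.
rewrite /u; case: pickle_inv => // -[i j] /=.
apply/sub_clspan/mem_prodset; last exact: (proj2 (Mn j)).
exact/mem_adjset/(proj1 (Mn i)).
Qed.

(** With [u_k^*] and [u_k] as the two sequences, both families of partial sums are the [U k]. The
    limit on the right is the adjoint of the limit on the left, since [clspan Q] and [U k] are
    self-adjoint. *)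
Lemma sigma_TRO_support_of_sequences : TRO M -> sigma_TRO (clspan Q).
Proof.
move=> TROM; have [sQ cQ] := clspan_operator_space Q.
have adjQ x : clspan Q x -> clspan Q (adj x).
  by move=> Qx; rewrite -adjset_clspan_support; exact: mem_adjset.
split=> //.
  split=> //; rewrite adjset_clspan_support.
  apply: subset_trans (clspan_support_mul TROM); apply: prodset_sub => //.
  exact: clspan_support_mul.
exists (fun k => adj (u k)), u; split.
- by move=> k; split; [exact/adjQ/Qu|exact: Qu].
- move=> x Qx; apply/cvg_rnormP => e e0.
  have [N _ xN] := U_lim Qx e0; exists N => k /xN.
  rewrite /= /U /gram bcomp_suml.
  by under [in X in _ -> X]eq_bigr do rewrite adjK.
- move=> x Qx; apply/cvg_rnormP => e e0.
  have [N _ xN] := U_lim (adjQ _ Qx) e0; exists N => k /xN /=.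
  rewrite -rnorm_adj adjB adjM !adjK adj_gram /gram bcomp_sumr.
  by under [in X in X -> _]eq_bigr do rewrite bcompA.
- move=> k; rewrite [leLHS](_ : _ = `|U k|); first by rewrite norm_leE.
  by congr (`|_|); apply: eq_bigr => i _; rewrite adjK.
- by move=> k; rewrite norm_leE; exact: U_le1.
Qed.

End SupportSigmaTRO.

Lemma sigma_TRO_support (R : realType) (H K : hilbertType R) (M : set 'B(H, K)) :
  sigma_TRO M -> sigma_TRO (clspan (M^⋆ ** M)).
Proof.
move=> [TROM _ [m [n [Mn ml nl m1 n1]]]].
exact: (sigma_TRO_support_of_sequences Mn ml nl m1 n1 TROM).
Qed.

Section Supports.
Variables (R : realType) (H K : hilbertType R) (M : set 'B(H, K)).
Hypothesis sM : sigma_TRO M.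

Let Q := M^⋆ ** M.

(** Because the [d k] are self-adjoint, they also act as a left approximate unit on the adjoints of
    elements of [M]. *)
Lemma sigma_TRO_approx_unit : exists d : nat -> 'B(H, H),
  [/\ forall k, clspan Q (d k), forall k, adj (d k) = d k, forall k, rnorm (d k) <= 1 &
      M `<=` right_fixed \oo d].
Proof.
case: sM => [TROM _ [m [n [Mn _ nl _ n1]]]].
exists (fun k => gram (index_iota 0 k) n); split.
- move=> k; apply: subspace_sum => [|j _]; first by case: (clspan_operator_space Q).
  apply/sub_clspan/mem_prodset; last exact: (proj2 (Mn j)).
  exact/mem_adjset/(proj2 (Mn j)).
- by move=> k; exact: adj_gram.
- by move=> k; exact: ngram_le1.
- exact: (ngram_lim nl).
Qed.

(** Each [x] in [M] is the limit of [x d_k], with [d_k] in the closed span of [Q]. *)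
Lemma sigma_TRO_nondegenerate : clspan (M ** Q) = M.
Proof.
have [[sM0 MM] cM _] := sM; have oM : operator_space M by [].
apply/seteqP; split.
  by apply: clspan_min => //; rewrite prodsetA.
have [d [dQ _ _ dl]] := sigma_TRO_approx_unit.
move=> x Mx; have [_ cX] := clspan_operator_space (M ** Q); apply: cX.
apply/closure_rnormP => e e0; have [k _ /(_ _ (leqnn k)) xk] := dl x Mx e e0.
exists (x \ob d k); last by rewrite rdistC.
rewrite -clspan_clspanr; exact/sub_clspan/mem_prodset.
Qed.

Lemma clspan_support_idem : clspan (Q ** Q) = clspan Q.
Proof.
rewrite -[in X in Q ** X]/Q {1}/Q -prodsetA -clspan_clspanr.
by rewrite sigma_TRO_nondegenerate.
Qed.

End Supports.

(** * A contractive approximate identity for the compressed algebra *)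

Section Nets.
Variables (I : Type) (le : I -> I -> Prop).
Hypothesis dle : directed le.

(** The filter generated by the tails of a net; along it the net limits become filter limits. *)
Definition net_filter : set_system I :=
  [set P | exists i0, forall i, le i0 i -> P i].

Lemma net_filter_filter : Filter net_filter.
Proof.
case: dle => -[i0] _ tle dir; split.
- by exists i0.
- move=> P P' [j Pj] [k Pk]; have [l [jl kl]] := dir j k.
  by exists l => s ls; split; [apply: Pj|apply: Pk]; exact: tle ls.
- by move=> P P' PP [j Pj]; exists j => s /Pj /PP.
Qed.

Lemma net_filter_ex (P : set I) : net_filter P -> exists i, P i.
Proof. by case: dle => _ rle _ _ [i Pi]; exists i; exact/Pi/rle. Qed.

End Nets.

Lemma directed_prod_nat (I : Type) (le : I -> I -> Prop) : directed le ->
  directed (fun p q : I * nat => le p.1 q.1 /\ (p.2 <= q.2)%N).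
Proof.
case=> -[i0] rle tle dir; split=> [|p|p q r [pq pq'] [qr qr']|p q].
- exact: (inhabits (i0, 0%N)).
- by split=> //; exact: rle.
- by split; [exact: tle qr|exact: leq_trans qr'].
- have [k [pk qk]] := dir p.1 q.1; exists (k, maxn p.2 q.2) => /=.
  by rewrite leq_maxl leq_maxr.
Qed.

(** Telescoping gives three terms, each a product of contractions applied to [d x - x] or
    [e x - x]. *)
Lemma sandwich_lt (R : realType) (H : hilbertType R) (d e x : 'B(H, H)) (b : R) :
  rnorm d <= 1 -> rnorm e <= 1 -> rnorm (d \ob x - x) < b -> rnorm (e \ob x - x) < b ->
  rnorm (d \ob e \ob d \ob x - x) < b + b + b.
Proof.
have con (S T : 'B(H, H)) : rnorm S <= 1 -> rnorm (S \ob T) <= rnorm T.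
  move=> S1; apply: le_trans (bcomp_norm S T) _.
  exact: ler_piMl (rnorm_ge0 T) S1.
move=> d1 e1 dx ex.
have -> : d \ob e \ob d \ob x - x =
    d \ob (e \ob (d \ob x - x)) + d \ob (e \ob x - x) + (d \ob x - x).
  by rewrite !bcompBr !bcompA !addrA !subrK.
apply: le_lt_trans (rnormD _ _) _; apply: (ltrD _ dx).
apply: le_lt_trans (rnormD _ _) _; apply: ltrD.
- by apply: le_lt_trans dx; apply: le_trans (con _ _ d1) _; exact: con.
- exact: le_lt_trans (con _ _ d1) ex.
Qed.

Section SupportCai.
Variables (R : realType) (H K : hilbertType R).
Variables (M : set 'B(H, K)) (al : set 'B(H, H)).
Hypothesis sM : sigma_TRO M.

Let Q := M^⋆ ** M.
Hypothesis Qal : Q ** al `<=` al.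

(* [z q] need not a priori lie in [al], but [(z q)^*] is a limit of elements
   [(q^* e_k) z^*] of [al al^*], on which [e_i^*] acts as an approximate unit. *)
Lemma cai_right_support (I : Type) (F : set_system I) (FF : ProperFilter F)
    (e : I -> 'B(H, H)) (z q : 'B(H, H)) :
  (forall i, al (e i)) -> (forall i, rnorm (e i) <= 1) ->
  al `<=` left_fixed F e -> al `<=` right_fixed F e ->
  al z -> Q q -> right_fixed F e (z \ob q).
Proof.
move=> ale e1 el er alz Qq; apply/left_fixed_adjP; rewrite adjM.
have e1' i : rnorm (adj (e i)) <= 1 by rewrite rnorm_adj.
have Qq' : Q (adj q) by rewrite /Q -adjset_support; exact: mem_adjset.
have ez : left_fixed F e (adj z).
  have /(left_fixed_adj FF e1') ez' := (left_fixed_adjP FF e z).1 (er z alz).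
  by move=> c /ez'; apply: filterS => i; rewrite adjK.
have [_ cW] := @left_fixed_operator_space _ H _ _ _ FF _ e1'.
apply: cW; apply/closure_rnormP => c c0.
have q1 : 0 < rnorm q + 1 by rewrite ltr_wpDl ?rnorm_ge0.
have c1 : 0 < c / (rnorm q + 1) by rewrite divr_gt0.
have [k] := filter_ex (ez _ c1); rewrite ltr_pdivlMr// => ek.
exists (adj q \ob e k \ob adj z); last first.
  rewrite rdistC -bcompA -bcompBr (le_lt_trans (bcomp_norm _ _))// rnorm_adj mulrC.
  by apply: le_lt_trans ek; rewrite ler_wpM2l ?rnorm_ge0// lerDl.
apply: left_fixedM; apply: left_fixed_adj => //; apply: el.
by apply: Qal; exact: mem_prodset.
Qed.

Lemma support_approximately_unital :
  approximately_unital al -> approximately_unital (clspan (Q ** al ** Q)).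
Proof.
move=> [I [le [e [dle ale cai]]]].
have [d [dQ dadj d1 dr]] := sigma_TRO_approx_unit sM.
pose F := net_filter le.
have FF : ProperFilter F.
  apply: Build_ProperFilter; last exact: net_filter_filter.
  by move=> /(net_filter_ex dle)[].
have e1 i : rnorm (e i) <= 1 by rewrite -norm_leE; exact: (proj2 (ale i)).
have eal i : al (e i) := proj1 (ale i).
have cR (c : R) : 0 < c -> (0 : R[i]) < c%:C by rewrite ltcR.
have el : al `<=` left_fixed F e.
  move=> x alx c /cR c0; have [i0 i0P] := cai x alx _ c0.
  by exists i0 => i /i0P[]; rewrite norm_ltE.
have er : al `<=` right_fixed F e.
  move=> x alx c /cR c0; have [i0 i0P] := cai x alx _ c0.
  by exists i0 => i /i0P[_]; rewrite norm_ltE.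
set A0 := clspan _.
(* A generator begins with a factor in [Q ** al], which lies in [al]. *)
have eA : A0 `<=` left_fixed F e.
  apply: (clspan_min (@left_fixed_operator_space _ H _ _ _ FF _ e1)).
  move=> _ [y Qy [q Qq <-]]; apply: left_fixedM; apply: el; exact: Qal.
have Ae : A0 `<=` right_fixed F e.
  apply: (clspan_min (@right_fixed_operator_space _ H _ _ _ FF _ e1)).
  move=> _ [_ [p Qp [z alz <-]] [q Qq <-]]; rewrite -(bcompA p).
  apply: right_fixedM; exact: (cai_right_support FF eal e1 el er alz Qq).
(* A generator begins with some [m^*], and [d_k m^*] is the adjoint of [m d_k]. *)
have dA : A0 `<=` left_fixed \oo d.
  apply: (clspan_min (@left_fixed_operator_space _ H _ _ _ _ _ d1)).
  move=> _ [_ [_ [_ [m Mm <-] [n Mn <-]] [z alz <-]] [q Qq <-]]; rewrite -!bcompA.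
  apply: left_fixedM => c c0; apply: filterS (dr m Mm c c0) => k.
  by rewrite -rnorm_adj adjB adjM dadj.
have Ad : A0 `<=` right_fixed \oo d.
  apply: (clspan_min (@right_fixed_operator_space _ H _ _ _ _ _ d1)).
  move=> _ [x _ [_ [_ [m Mm <-] [n Mn <-]] <-]]; rewrite bcompA.
  by apply: right_fixedM; exact: dr.
exists (I * nat)%type, (fun p q => le p.1 q.1 /\ (p.2 <= q.2)%N),
  (fun p => d p.2 \ob e p.1 \ob d p.2); split.
- exact: directed_prod_nat.
- move=> [i k] /=; split.
    (* The operator [d k] lies only in the closed span of [Q], so both outer factors are first
       replaced by [clspan Q]. *)
    rewrite /A0 -clspan_clspanr -prodsetA -clspan_clspanl prodsetA.
    by apply/sub_clspan/mem_prodset => //; apply: mem_prodset.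
  rewrite norm_leE (le_trans (bcomp_norm _ _))//.
  rewrite mulr_ile1 ?rnorm_ge0// (le_trans (bcomp_norm _ _))//.
  by rewrite mulr_ile1 ?rnorm_ge0.
- move=> x Ax c c0; pose b := complex.Re c / 3.
  have b0 : 0 < b by rewrite divr_gt0// gt0_Re.
  have [i0 i0P] : F [set i | rnorm (e i \ob x - x) < b /\ rnorm (x \ob e i - x) < b].
    by apply: filterI; [exact: eA|exact: Ae].
  have [k0 _ k0P] : \forall k \near \oo,
      rnorm (d k \ob x - x) < b /\ rnorm (x \ob d k - x) < b.
    by apply: filterI; [exact: dA|exact: Ad].
  exists (i0, k0) => -[i k] [/= /i0P[ei ie] /k0P[dk kd]].
  have cE : complex.Re c = b + b + b by rewrite /b; field.
  rewrite !norm_ltE// cE; split; first exact: sandwich_lt.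
  (* The estimate on the right is the one on the left for the adjoints of [e i] and [x], as [d k] is
     self-adjoint. *)
  rewrite -rnorm_adj adjB !adjM dadj bcompA.
  apply: sandwich_lt; rewrite ?rnorm_adj//.
    by rewrite -[d k]dadj -adjM -adjB rnorm_adj.
  by rewrite -adjM -adjB rnorm_adj.
Qed.

End SupportCai.

(** * Transfer to the image of the represented algebra *)

(** The case of one-by-one matrices, by which a complete isometry is an isometry. *)
Lemma matrix_opnorm1 (R : realType) (H K : hilbertType R) (T : 'B(H, K)) :
  matrix_opnorm (const_mx T : 'M['B(H, K)]_1) = rnorm T.
Proof.
rewrite /matrix_opnorm; congr sup; apply/seteqP; split=> r.
- move=> [x /=]; rewrite big_ord1 => x1 <-; rewrite !big_ord1 mxE.
  exists (x ord0); last by rewrite sqrtr_sqr ger0_norm ?rnorm_ge0.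
  by rewrite /= -(@ler_pXn2r _ 2) ?nnegrE ?rnorm_ge0 ?ler01// expr1n.
- move=> [x /= x1 <-]; exists (fun=> x) => /=.
    by rewrite big_ord1 expr_le1 ?rnorm_ge0.
  by rewrite !big_ord1 mxE sqrtr_sqr ger0_norm ?rnorm_ge0.
Qed.

Section Image.
Variables (R : realType) (E H : hilbertType R) (A : set 'B(E, E)).
Variable a : 'B(E, E) -> 'B(H, H).
Hypothesis oA : operator_algebra A.
Hypothesis ha : ci_homomorphism A a.

Lemma ci_homomorphism_rnorm T : A T -> rnorm (a T) = rnorm T.
Proof.
move=> AT; have [[_ /(_ 1%N (const_mx T)) aT] _] := ha.
by rewrite -!matrix_opnorm1 -map_const_mx aT// => i j; rewrite mxE.
Qed.

Lemma ci_homomorphism_distE S T : A S -> A T -> rnorm (a S - a T) = rnorm (S - T).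
Proof.
move=> AS AT; have [[aL _] _] := ha.
have -> : a S - a T = a (S - T).
  by rewrite -scaleN1r addrC -aL// scaleN1r addrC.
rewrite ci_homomorphism_rnorm//; apply: subspaceB => //.
by case: oA => -[].
Qed.

Lemma image_mul : (a @` A) ** (a @` A) `<=` a @` A.
Proof.
have [_ aM] := ha; have [_ AA] := oA.
move=> _ [_ [S AS <-] [_ [T AT <-] <-]]; exists (S \ob T); last exact: aM.
exact/AA/mem_prodset.
Qed.

Lemma image_approximately_unital : approximately_unital A ->
  approximately_unital (a @` A).
Proof.
have [_ aM] := ha; have [_ AA] := oA.
move=> [I [le [e [dle Ae cai]]]]; exists I, le, (a \o e); split=> //.
  move=> i /=; have [Aei e1] := Ae i; split; first by exists (e i).
  by rewrite -rnormE ci_homomorphism_rnorm// rnormE.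
move=> _ [T AT <-] eps eps0; have [i0 i0P] := cai T AT eps eps0.
exists i0 => i /i0P[eT Te]; have [Aei _] := Ae i.
have AeT : A (e i \ob T) by exact/AA/mem_prodset.
have ATe : A (T \ob e i) by exact/AA/mem_prodset.
by rewrite /= -!aM// !norm_ltE// !ci_homomorphism_distE// -!norm_ltE.
Qed.

End Image.

(** * The restriction as a doubly rigged module and its equivalences *)

(** For [X = Q] this yields that [A0] absorbs [Q] on the left, for [X = M] that [M] carries [A0]
    onto the restriction. *)
Lemma clspan_absorbl (R : realType) (H K L P Z : hilbertType R) (X : set 'B(P, L))
    (Q : set 'B(K, P)) (W : set 'B(H, K)) (V : set 'B(Z, H)) (X' : set 'B(K, L)) :
  clspan (X ** Q) = clspan X' -> clspan (X ** clspan (Q ** W ** V)) = clspan (X' ** W ** V).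
Proof.
move=> XQ; rewrite clspan_clspanr -prodsetA prodsetA -clspan_clspanl XQ.
by rewrite clspan_clspanl prodsetA.
Qed.

Lemma clspan_absorbr (R : realType) (H K L P : hilbertType R) (X : set 'B(P, L))
    (Q : set 'B(K, P)) (Q' : set 'B(H, K)) (Q'' : set 'B(H, P)) :
  clspan (Q ** Q') = clspan Q'' -> clspan (clspan (X ** Q) ** Q') = clspan (X ** Q'').
Proof.
by move=> QQ; rewrite clspan_clspanl -prodsetA -clspan_clspanr QQ clspan_clspanr.
Qed.

Section Restriction.
Variables (R : realType) (H K : hilbertType R).
Variables (M : set 'B(H, K)) (al : set 'B(H, H)).
Hypothesis sM : sigma_TRO M.

Let Q := M^⋆ ** M.
Hypothesis Qal : Q ** al `<=` al.
Hypothesis alal : al ** al `<=` al.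

Let D := clspan Q.
Let A0 := clspan (Q ** al ** Q).

(** In a product [x z q p w r] of generators the middle [z q p w] stays in [al], since [Q] maps [al]
    into itself. Taking [X = Q] shows that [A0] is an algebra, and [X = M] that it acts on the
    restriction. *)
Lemma compression_mul (L : hilbertType R) (X : set 'B(H, L)) :
  clspan (X ** al ** Q) ** A0 `<=` clspan (X ** al ** Q).
Proof.
apply: clspan_prodl; first exact: clspan_operator_space.
apply: clspan_prodr; first exact: clspan_operator_space.
apply: subset_trans (@sub_clspan _ _ _ _).
move=> _ [_ [_ [x Xx [z alz <-]] [q Qq <-]] [_ [_ [p Qp [w alw <-]] [r Qr <-]] <-]].
have v : al (z \ob (q \ob (p \ob w))).
  by apply/alal/mem_prodset => //; do 2 (apply/Qal/mem_prodset => //).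
rewrite [X in (_ ** _) X](_ : _ = x \ob (z \ob (q \ob (p \ob w))) \ob r).
  by apply: mem_prodset => //; exact: mem_prodset.
by rewrite !bcompA.
Qed.

Lemma support_compression : clspan (Q ** A0) = A0.
Proof. exact/clspan_absorbl/clspan_support_idem. Qed.

Lemma compression_support : clspan (A0 ** Q) = A0.
Proof. exact/clspan_absorbr/clspan_support_idem. Qed.

Lemma clspan_support_compression : clspan (D ** A0) = A0.
Proof. by rewrite clspan_clspanl support_compression. Qed.

Lemma clspan_compression_support : clspan (A0 ** D) = A0.
Proof. by rewrite clspan_clspanr compression_support. Qed.

Lemma restrictionE : restriction M (clspan (M ** al)) = clspan (M ** al ** Q).
Proof. exact: clspan_clspanl. Qed.

Lemma clspan_module : clspan (M ** A0) = clspan (M ** al ** Q).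
Proof.
apply: clspan_absorbl; rewrite (sigma_TRO_nondegenerate sM) clspan_id//.
by case: sM => -[].
Qed.

Lemma adjset_module : clspan (M^⋆ ** clspan (M ** al ** Q)) = A0.
Proof. by rewrite -clspan_module clspan_clspanr prodsetA support_compression. Qed.

(** Reflexivity is implemented by the self-adjoint [D], which [A0] absorbs on both sides. *)
Lemma compression_equiv : sigma_TRO_equiv A0 A0.
Proof.
have sD := sigma_TRO_support sM.
exists D, D; split=> //; rewrite adjset_clspan_support -[RHS]clspan_clspanl;
  by rewrite clspan_support_compression clspan_compression_support.
Qed.

(** Here [D] acts on the domain side and [M] on the range side: [A0 = [M^* Z D]] and [Z =
    [M A0 D]]. *)
Lemma compression_restriction_equiv : sigma_TRO_equiv A0 (clspan (M ** al ** Q)).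
Proof.
have sD := sigma_TRO_support sM.
exists D, M; split=> //.
- by rewrite -[RHS]clspan_clspanl adjset_module clspan_compression_support.
- rewrite adjset_clspan_support -(prodsetA M A0) -(clspan_clspanr M).
  by rewrite clspan_compression_support clspan_module.
Qed.

Lemma restriction_doubly_rigged :
  doubly_sigma_rigged_module A0 (clspan (M ** al ** Q)) (@bcomp R H H K).
Proof.
split; first exact: clspan_operator_space.
- split=> [y x Zy Ax|c y z x _ _ _|c y x w _ _ _|y x w _ _ _].
  + by apply: compression_mul; exact: mem_prodset.
  + by rewrite bcompDl bcompZl.
  + by rewrite bcompDr bcompZr.
  + exact: bcompA.
- have ci (L P : hilbertType R) (X : set 'B(L, P)) : complete_isometry_on X id.
    split=> // n T _; congr matrix_opnorm; apply/matrixP => i j; exact: mxE.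
  (* The algebra and the module are already concrete, so both maps are identities; the doubly rigged
     condition holds because both closed spans equal [A0]. *)
  exists H, K, id, M, id; split; last first.
    by rewrite image_id -/Q support_compression compression_support.
  split=> //.
  + by rewrite image_id -{2}support_compression; exact: sub_clspan.
  + by split=> //; rewrite !image_id clspan_module.
Qed.

End Restriction.

Theorem theorem3p5 (R : realType) (E H K : hilbertType R)
    (A : set 'B(E, E)) (a : 'B(E, E) -> 'B(H, H)) (M : set 'B(H, K)) :
  operator_algebra A -> approximately_unital A ->
  ci_homomorphism A a ->
  sigma_TRO M ->
  M^⋆ ** M ** (a @` A) `<=` a @` A ->
  let Y := clspan (M ** (a @` A)) in
  exists (H0 K0 : hilbertType R) (A0 : set 'B(H0, H0)) (B : set 'B(K0, K0))
    (Z : set 'B(H, K)) (act : 'B(H, K) -> 'B(H0, H0) -> 'B(H, K)),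
    [/\ operator_algebra A0 /\ approximately_unital A0,
        operator_algebra B /\ approximately_unital B,
        Z = restriction M Y,
        doubly_sigma_rigged_module A0 Z act &
        sigma_TRO_equiv A0 B /\ sigma_TRO_equiv B Z].
Proof.
move=> oA uA ha sM MA Y.
(* The image of [A] under [a] inherits products and the approximate identity, so it can play the
   role of [al]. *)
have AA := image_mul oA ha.
have A0P : operator_algebra (clspan (M^⋆ ** M ** (a @` A) ** (M^⋆ ** M))) /\
    approximately_unital (clspan (M^⋆ ** M ** (a @` A) ** (M^⋆ ** M))).
  split; first by split; [exact: clspan_operator_space|exact: compression_mul].
  exact/(support_approximately_unital sM MA)/(image_approximately_unital oA ha).
exists H, H, (clspan (M^⋆ ** M ** (a @` A) ** (M^⋆ ** M))),
  (clspan (M^⋆ ** M ** (a @` A) ** (M^⋆ ** M))),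
  (clspan (M ** (a @` A) ** (M^⋆ ** M))), (@bcomp R H H K); split=> //.
- by rewrite /Y restrictionE.
- exact: restriction_doubly_rigged.
- split; first exact: compression_equiv.
  exact: compression_restriction_equiv.
Qed.
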